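(* Let $n\geq1$ and let $(A,\phi)$ be an alternate module. The following are equivalent: (1) there exists an irreducible subgroup $H$ of $SL(n,\mathbb{C})$ such that $(Z_n(H),\phi_H)$ is isometric to $(A,\phi)$; (2) the order $n_{A,\phi}$ of the Lagrangians of $(A,\phi)$ divides $n$; (3) there exists an abelian group $B$ of order $n$ such that $(A,\phi)$ embeds isometrically into $B\times B^*$ with its canonical symplectic form. Moreover, every centralizer of an irreducible subgroup of $PSL(n,\mathbb{C})$ is contained in a centralizer of an irreducible subgroup of $PSL(n,\mathbb{C})$ of order $n^2$; hence the centralizers of order $n^2$ are exactly the maximal ones (for inclusion) among centralizers of irreducible subgroups.
   Context: Let $\xi=e^{2\pi i/n}$ and $\pi_n:SL(n,\mathbb{C})\to PSL(n,\mathbb{C})$. A subgroup of $SL(n,\mathbb{C})$ is irreducible if no nonzero proper subspace of $\mathbb{C}^n$ is invariant; a subgroup of $PSL(n,\mathbb{C})$ is irreducible if its preimage is. $Z_n(H)=Z_{PSL(n,\mathbb{C})}(\pi_n(H))$, $U_n(H)=\pi_n^{-1}(Z_n(H))$, and $\phi_H(a,b)=k/n\in\mathbb{Q}/\mathbb{Z}$ where $\hat a\hat b\hat a^{-1}\hat b^{-1}=\xi^kI_n$ for lifts $\hat a,\hat b\in U_n(H)$. An alternate module is a finite abelian group $A$ with biadditive $\phi:A\times A\to\mathbb{Q}/\mathbb{Z}$, $\phi(a,a)=0$; radical $K_\phi=\{a:\phi(a,\cdot)=0\}$; a subgroup $L$ is Lagrangian if $L=L^\perp$; all Lagrangians have order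 $n_{A,\phi}=\sqrt{|A||K_\phi|}$. An isometric embedding is an injective form-preserving homomorphism. For finite abelian $B$, $B^*=\mathrm{Hom}(B,\mathbb{Q}/\mathbb{Z})$ and $B\times B^*$ has the form $\phi((b,f),(b',f'))=f'(b)-f(b')$. *)

(* Defs.v *)
From HB Require Import structures.
From mathcomp Require Import all_boot all_order all_algebra all_fingroup all_field.
Set Implicit Arguments. Unset Strict Implicit. Unset Printing Implicit Defensive.
Import Order.TTheory GRing.Theory Num.Theory.
Local Open Scope ring_scope.

(* The group Q/Z, realised as the rationals in [0,1) with addition mod 1 *)

Definition frac (q : rat) : rat := q - (Num.floor q)%:~R.

Lemma frac_itv q : (0 <= frac q) && (frac q < 1).
Proof.
rewrite /frac subr_ge0 floor_le /= ltrBlDl.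
by have := floorD1_gt q; rewrite intrD.
Qed.

Lemma fracDz x (m : int) : frac (x + m%:~R) = frac x.
Proof.
rewrite /frac floorDrz ?intr_int // intrKfloor intrD.
by rewrite opprD addrACA subrr addr0.
Qed.

Lemma frac_id q : (0 <= q) && (q < 1) -> frac q = q.
Proof.
move=> /andP[h0 h1]; rewrite /frac (@floor_def _ q 0) ?subr0 //.
by rewrite h0 /= add0r.
Qed.

Lemma fracDl x y : frac (frac x + y) = frac (x + y).
Proof.
have -> : frac x + y = (x + y) + (- Num.floor x)%:~R by rewrite /frac intrN addrAC.
exact: fracDz.
Qed.

Definition QZ := {q : rat | (0 <= q) && (q < 1)}.
HB.instance Definition _ := Choice.copy QZ {q : rat | (0 <= q) && (q < 1)}.

Definition qz_of (q : rat) : QZ := exist _ (frac q) (frac_itv q).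
Definition qz_zero : QZ := qz_of 0.
Definition qz_opp (a : QZ) : QZ := qz_of (- sval a).
Definition qz_add (a b : QZ) : QZ := qz_of (sval a + sval b).

Lemma qz_val (a : QZ) : frac (sval a) = sval a.
Proof. by case: a => q Hq; exact: frac_id. Qed.

Lemma qz_addA : associative qz_add.
Proof.
move=> a b c; apply: val_inj => /=.
rewrite fracDl [_ + frac _]addrC fracDl. congr frac. by rewrite addrC addrA.
Qed.

Lemma qz_addC : commutative qz_add.
Proof. by move=> a b; apply: val_inj; rewrite /= addrC. Qed.

Lemma qz_add0 : left_id qz_zero qz_add.
Proof.
move=> a; apply: val_inj => /=.
by rewrite fracDl add0r qz_val.
Qed.

Lemma qz_addN : left_inverse qz_zero qz_opp qz_add.
Proof. by move=> a; apply: val_inj; rewrite /= fracDl addNr. Qed.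

HB.instance Definition _ := GRing.isZmodule.Build QZ qz_addA qz_addC qz_add0 qz_addN.

Definition alternate (A : finZmodType) (phi : A -> A -> QZ) : Prop :=
  [/\ (forall a b c, phi (a + b) c = phi a c + phi b c),
      (forall a b c, phi a (b + c) = phi a b + phi a c) &
      (forall a, phi a a = 0)].

Definition radical (A : finZmodType) (phi : A -> A -> QZ) : {set A} :=
  [set a : A | [forall b, phi a b == 0]].

(* "n_{A,phi} = sqrt(|A| |K_phi|) divides n" *)
Definition lagr_order_dvd (A : finZmodType) (phi : A -> A -> QZ) (n : nat) : Prop :=
  exists m : nat, (m * m = #|A| * #|radical phi|)%N /\ (m %| n)%N.

(* An isometric embedding of (A, phi) into B x B^* (B^* = Hom(B, Q/Z)),
   a |-> (eb a, ef a), with the canonical form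
   phi((b,f),(b',f')) = f'(b) - f(b'). *)
Definition isometric_embedding_BBstar (A : finZmodType) (phi : A -> A -> QZ)
    (B : finZmodType) : Prop :=
  exists (eb : A -> B) (ef : A -> B -> QZ),
  [/\ (forall a x y, ef a (x + y) = ef a x + ef a y),
      (forall a a', eb (a + a') = eb a + eb a'),
      (forall a a' x, ef (a + a') x = ef a x + ef a' x),
      (forall a a', eb a = eb a' -> (forall x, ef a x = ef a' x) -> a = a')
                                                               (* injective *) &
      (forall a a', phi a a' = ef a' (eb a) - ef a (eb a'))].

Definition SL_subgroup (F : fieldType) (n : nat) (H : 'M[F]_n -> Prop) : Prop :=
  [/\ H 1%:M,
      (forall g h, H g -> H h -> H (g *m h)),
      (forall g, H g -> H (invmx g)) &
      (forall g, H g -> \det g = 1)].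

Definition irreducible_SL_subgroup (F : fieldType) (n : nat) (H : 'M[F]_n -> Prop) : Prop :=
  SL_subgroup H /\
  forall U : 'M[F]_n, (forall g, H g -> (U *m g <= U)%MS) -> U = 0 \/ row_full U.

(* U_n(H) = pi_n^{-1}(Z_{PSL}(pi_n(H))): g in SL(n) whose commutator with
   every element of H is scalar *)
Definition in_U (F : fieldType) (n : nat) (H : 'M[F]_n -> Prop) (g : 'M[F]_n) : Prop :=
  \det g = 1 /\ forall h, H h -> exists c : F, g *m h = c *: (h *m g).

(* g and g' have the same image in PSL (g' is a scalar multiple of g) *)
Definition proj_eq (F : fieldType) (n : nat) (g g' : 'M[F]_n) : Prop :=
  exists c : F, g' = c *: g.

(* (Z_n(H), phi_H) is isometric to (A, phi): s : A -> U_n(H) is a lift of a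
   group isomorphism A -> Z_n(H) = U_n(H)/scalars, carrying phi to phi_H,
   where phi_H(pi a, pi b) = k/n iff a b a^-1 b^-1 = xi^k I. *)
Definition centralizer_isometric (F : fieldType) (n : nat) (xi : F)
    (H : 'M[F]_n -> Prop) (A : finZmodType) (phi : A -> A -> QZ) : Prop :=
  exists s : A -> 'M[F]_n,
  [/\ (forall a, in_U H (s a)),
      (forall g, in_U H g -> exists a, proj_eq (s a) g),
      (forall a b, proj_eq (s a) (s b) -> a = b),
      (forall a b, proj_eq (s a *m s b) (s (a + b))) &
      (forall a b (k : nat), s a *m s b = xi ^+ k *: (s b *m s a) ->
          phi a b = qz_of (k%:R / n%:R))].

Definition centralizer_card (F : fieldType) (n : nat) (H : 'M[F]_n -> Prop) (m : nat) : Prop :=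
  exists s : 'I_m -> 'M[F]_n,
  [/\ (forall i, in_U H (s i)),
      (forall g, in_U H g -> exists i, proj_eq (s i) g) &
      (forall i j, proj_eq (s i) (s j) -> i = j)].

(* Main.v *)
Require Import Defs.
From HB Require Import structures.
From mathcomp Require Import all_boot all_order all_algebra all_fingroup all_field all_solvable.
From mathcomp Require Import ring.
From Stdlib Require Import Classical.
Set Implicit Arguments. Unset Strict Implicit. Unset Printing Implicit Defensive.
Import Order.TTheory GRing.Theory Num.Theory.
Local Open Scope ring_scope.

(** The commutator form of an irreducible subgroup [H] makes [U_n(H)]/scalars an alternate module
    [A] with a projective representation on [F^n] in which every nonzero element has trace zero:
    an element of [U_n(H)] is conjugated by some [h] in [H] to a multiple of itself by a scalar
    other than 1, unless it is scalar (Schur).  On a Lagrangian [L] the representation can be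
    rescaled to a homomorphism by means of a common eigenvector, and the projector
    [1/|L| sum_L s(l)] has trace, hence rank, [n/|L|]; so [|L|] divides [n].

    Conversely, an alternate module embeds into a nondegenerate one of order [|A| |K|]: adjoin an
    element [w] with [d w = b], where [d] is the exponent of the radical [K] and [w] pairs with [A]
    through a character [psi] of order [d] on [K] such that [d psi = phi(b, -)] and [psi(b) = 0];
    this divides the radical by [d].  Nondegenerate modules have symplectic bases, so they embed
    in some [B x B^*], which acts on functions on [B] by translations and modulations.  If [A] lies
    in such a [W] of order [n^2], the group of all matrices commuting projectively with [A] has
    centralizer [A], because [A] is its own biorthogonal in [W].

    Finally, two trace-zero projective representations of [A] of the same dimension and with the
    same commutator form are projectively equivalent, so that the given action of [A = Z_n(H)] is
    the restriction of an action of [W]; the matrices of [W] form the required larger group. *)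

(** * Characters of finite subgroups of Q/Z *)

Lemma qz_ofD (x y : rat) : qz_of (x + y) = qz_of x + qz_of y.
Proof.
apply: val_inj; rewrite -[RHS]/(Defs.frac (Defs.frac x + Defs.frac y)).
by rewrite fracDl [X in _ = Defs.frac X]addrC fracDl [X in _ = Defs.frac X]addrC.
Qed.

Lemma qz_of0 : qz_of 0 = 0.
Proof. by []. Qed.

Lemma qz_ofN x : qz_of (- x) = - qz_of x.
Proof. by apply/eqP; rewrite -addr_eq0 -qz_ofD addNr. Qed.

Lemma qz_of_mulrn x k : qz_of (x *+ k) = qz_of x *+ k.
Proof. by elim: k => [|k IH]; rewrite ?mulr0n // !mulrS qz_ofD IH. Qed.

Lemma qz_ofK (q : QZ) : qz_of (sval q) = q.
Proof. by apply: val_inj; rewrite /= qz_val. Qed.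

Lemma qz_of_eq0 x : (qz_of x == 0) = (x \is a Num.int).
Proof.
apply/eqP/idP => [/(congr1 val) /= h|/intrP [m ->]].
  by move/eqP: h; rewrite /Defs.frac /= floor0 subr0 subr_eq0 => /eqP ->; rewrite intr_int.
by apply: val_inj; rewrite /= -[m%:~R]add0r fracDz.
Qed.

Lemma qz_of_nat k : qz_of k%:R = 0.
Proof. by apply/eqP; rewrite qz_of_eq0. Qed.

Lemma qz_of_frac_eq0 k N : (0 < N)%N -> (qz_of (k%:R / N%:R) == 0) = (N %| k)%N.
Proof.
move=> N0; have NN : (N%:R : rat) != 0 by rewrite pnatr_eq0 -lt0n.
rewrite qz_of_eq0; apply/idP/idP => [/intrP [m hm]|/dvdnP [q ->]]; last first.
  by rewrite natrM mulfK.
have : (k%:Z)%:~R = (m * N%:Z)%:~R :> rat by rewrite intrM -!pmulrn -hm divfK.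
by move/intr_inj/(congr1 absz); rewrite abszM /= => ->; rewrite dvdn_mull.
Qed.

Lemma qz_torsionP (q : QZ) N : (0 < N)%N -> q *+ N = 0 ->
  exists k : nat, q = qz_of (k%:R / N%:R).
Proof.
move=> N0 h; have NN : (N%:R : rat) != 0 by rewrite pnatr_eq0 -lt0n.
have : sval q *+ N \is a Num.int by rewrite -qz_of_eq0 qz_of_mulrn qz_ofK h.
have q0 : 0 <= sval q by case: (q) => x /= /andP [].
have h1 : 0 <= sval q *+ N by rewrite mulrn_wge0.
move=> hi; have : sval q *+ N \is a Num.nat by rewrite natrEint hi.
case/natrP => k hk; exists k; rewrite -[q in LHS]qz_ofK; congr qz_of.
by rewrite -hk -(mulr_natr (sval q)) mulfK.
Qed.

Lemma qz_divisible (q : QZ) N : (0 < N)%N -> exists r : QZ, r *+ N = q.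
Proof.
move=> N0; exists (qz_of (sval q / N%:R)).
by rewrite -qz_of_mulrn -(mulr_natr (_ / _)) divfK ?qz_ofK // pnatr_eq0 -lt0n.
Qed.

Lemma qz_of_fracD k l N : qz_of ((k + l)%:R / N%:R) = qz_of (k%:R / N%:R) + qz_of (l%:R / N%:R).
Proof. by rewrite natrD mulrDl qz_ofD. Qed.

Lemma qz_of_frac_mod k N : (0 < N)%N -> qz_of ((k %% N)%:R / N%:R) = qz_of (k%:R / N%:R).
Proof.
move=> N0; rewrite [in RHS](divn_eq k N) addnC qz_of_fracD.
have /eqP -> : qz_of ((k %/ N * N)%:R / N%:R) == 0 by rewrite qz_of_frac_eq0 // dvdn_mull.
by rewrite addr0.
Qed.

Lemma qz_of_frac_muln k N : qz_of (k%:R / N%:R) = qz_of (1 / N%:R) *+ k.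
Proof. by rewrite -qz_of_mulrn; congr qz_of; rewrite -mulrnAl. Qed.

Lemma qz_of_frac_trunc k N : (0 < N)%N ->
  Num.trunc (sval (qz_of (k%:R / N%:R)) *+ N) = (k %% N)%N.
Proof.
move=> N0; rewrite -qz_of_frac_mod //=.
have NN : (0 : rat) < N%:R by rewrite ltr0n.
rewrite frac_id; last first.
  by rewrite divr_ge0 ?ler0n //= ltr_pdivrMr // mul1r ltr_nat ltn_mod.
by rewrite -(mulr_natr (_ / _)) divfK ?gt_eqF // natrK.
Qed.

(* The character k/N |-> z^k of the [N]-torsion of Q/Z; the values off the torsion are junk. *)
Definition qexp (R : nzRingType) (z : R) (N : nat) (q : QZ) : R :=
  z ^+ Num.trunc (sval q *+ N).

Section Qexp.
Variables (R : nzRingType) (z : R) (N : nat).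
Hypothesis zprim : N.-primitive_root z.

Let N0 : (0 < N)%N. Proof. exact: prim_order_gt0 zprim. Qed.

Lemma qexpE k : qexp z N (qz_of (k%:R / N%:R)) = z ^+ k.
Proof.
by rewrite -(prim_expr_mod zprim k) /qexp qz_of_frac_trunc.
Qed.

Lemma qexpD p q : p *+ N = 0 -> q *+ N = 0 -> qexp z N (p + q) = qexp z N p * qexp z N q.
Proof.
move=> /(qz_torsionP N0) [k ->] /(qz_torsionP N0) [l ->].
by rewrite -qz_of_fracD !qexpE exprD.
Qed.

Lemma qexp_eq1 q : q *+ N = 0 -> (qexp z N q == 1) = (q == 0).
Proof.
move=> /(qz_torsionP N0) [k ->].
by rewrite qexpE qz_of_frac_eq0 // (prim_order_dvd zprim).
Qed.

Lemma qexp0 : qexp z N 0 = 1.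
Proof. by apply/eqP; rewrite qexp_eq1 ?mul0rn. Qed.

Lemma qexp_exp q : q *+ N = 0 -> qexp z N q ^+ N = 1.
Proof.
move=> /(qz_torsionP N0) [k ->].
by rewrite qexpE exprAC (prim_expr_order zprim) expr1n.
Qed.

End Qexp.

Lemma finzmod_card_mulrn (A : finZmodType) (x : A) : x *+ #|A| = 0.
Proof.
rewrite -FinRing.zmodXgE -cardsT; apply/eqP.
by rewrite -order_dvdn; apply: (@order_dvdG _ [set: A]%G); exact: in_setT.
Qed.

Section Additive.
Variables (U V : zmodType) (S : {pred U}) (f : U -> V).
Hypotheses (S_zmod : zmod_closed S) (fD : {in S &, {morph f : x y / x + y}}).

Lemma zmod_closed_mulrn x n : x \in S -> x *+ n \in S.
Proof.
move=> xS; elim: n => [|n IH]; first by rewrite mulr0n; case: S_zmod.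
by rewrite mulrS (GRing.zmod_closedD S_zmod).2.
Qed.

Lemma add_in0 : f 0 = 0.
Proof.
by apply: (addIr (f 0)); rewrite -fD ?addr0 ?add0r //; case: S_zmod.
Qed.

Lemma add_inN : {in S, {morph f : x / - x}}.
Proof.
move=> x xS; apply/eqP; rewrite -addr_eq0 -fD ?addNr ?add_in0 //.
by rewrite (GRing.zmod_closedN S_zmod).
Qed.

Lemma add_in_mulrn x n : x \in S -> f (x *+ n) = f x *+ n.
Proof.
move=> xS; elim: n => [|n IH]; first by rewrite !mulr0n add_in0.
by rewrite !mulrS fD ?IH // zmod_closed_mulrn.
Qed.
End Additive.

Lemma zmod_closedT (A : finZmodType) : zmod_closed [set: A].
Proof. by split=> [|x y _ _]; apply: in_setT. Qed.

(** Translation by [g] permutes [G] and multiplies the sum by [chi g], which differs from 1. *)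
Lemma char_sum (R : idomainType) (A : finZmodType) (G : {set A}) (chi : A -> R) g :
    zmod_closed G -> {in G &, forall x y, chi (x + y) = chi x * chi y} ->
    g \in G -> chi g != 1 ->
  \sum_(x in G) chi x = 0.
Proof.
move=> Gz chiM gG chi1; apply/eqP; set s := \sum_(x in G) _.
have : (chi g - 1) * s == 0.
  rewrite mulrBl mul1r subr_eq0; apply/eqP.
  rewrite /s [in RHS](reindex_inj (addrI g)) mulr_sumr /=.
  apply: eq_big => [x|x xG]; last by rewrite chiM.
  apply/idP/idP => [xG|h]; first by rewrite (GRing.zmod_closedD Gz).2.
  by rewrite -[x](addKr g) addrC; case: Gz => _; apply.
by rewrite mulf_eq0 subr_eq0 (negPf chi1).
Qed.

(** * Orthogonality and Lagrangians *)

Lemma sum_mem_pred (T : finType) (P : {set T}) (c : pred T) :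
  (\sum_(x in P) c x)%N = #|[set x in P | c x]|.
Proof. by rewrite -sum1dep_card big_mkcondr; apply: eq_bigr => x _; case: (c x). Qed.

Lemma qz_mulrn_card (A : finZmodType) (f : A -> QZ) x :
  {morph f : x y / x + y} -> f x *+ #|A| = 0.
Proof.
move=> fD; have fD' : {in [set: A] &, {morph f : x y / x + y}} by move=> ? ? _ _; apply: fD.
rewrite -(add_in_mulrn (zmod_closedT A) fD') ?finzmod_card_mulrn ?in_setT //.
exact: add_in0 (zmod_closedT A) fD'.
Qed.

Section Pairing.
Variables (X Y : finZmodType) (b : X -> Y -> QZ).
Hypotheses (bDl : forall x x' y, b (x + x') y = b x y + b x' y)
           (bDr : forall x y y', b x (y + y') = b x y + b x y').
Variables (P : {set X}) (Q : {set Y}).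
Hypotheses (Pz : zmod_closed P) (Qz : zmod_closed Q).

Let N := #|X|.
Let N0 : (0 < N)%N. Proof. by apply/card_gt0P; exists 0. Qed.
Let b_tors x y : b x y *+ N = 0.
Proof. exact: (@qz_mulrn_card X (fun x => b x y)). Qed.

(** The sum of [e (b x y)] over [P] and [Q] is computed in both orders: by [char_sum] an inner sum
    is the full cardinal when the fixed element is orthogonal to the other side, and 0 otherwise. *)
Lemma pairing_card :
  (#|[set x in P | [forall y in Q, (b x y == 0)%R]]| * #|Q| =
   #|P| * #|[set y in Q | [forall x in P, (b x y == 0)%R]]|)%N.
Proof.
have [z zP] := C_prim_root_exists N0.
pose e := qexp z N.
have row x : x \in P -> \sum_(y in Q) e (b x y) = (#|Q| * [forall y in Q, (b x y == 0)%R])%N%:R.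
  move=> xP; case: (boolP [forall y in Q, b x y == 0]) => [/forall_inP h|].
    rewrite muln1 (eq_bigr (fun=> 1)) ?sumr_const // => y yQ.
    by rewrite /e (eqP (h y yQ)) qexp0.
  rewrite negb_forall_in => /exists_inP [y yQ h].
  rewrite muln0 (char_sum Qz _ yQ) ?qexp_eq1 //.
  by move=> u v _ _; rewrite /e bDr qexpD.
have col y : y \in Q -> \sum_(x in P) e (b x y) = (#|P| * [forall x in P, (b x y == 0)%R])%N%:R.
  move=> yQ; case: (boolP [forall x in P, b x y == 0]) => [/forall_inP h|].
    rewrite muln1 (eq_bigr (fun=> 1)) ?sumr_const // => x xP.
    by rewrite /e (eqP (h x xP)) qexp0.
  rewrite negb_forall_in => /exists_inP [x xP h].
  rewrite muln0 (char_sum Pz _ xP) ?qexp_eq1 //.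
  by move=> u v _ _; rewrite /e bDl qexpD.
apply/eqP; rewrite -(eqr_nat algC) mulnC; apply/eqP.
transitivity (\sum_(x in P) \sum_(y in Q) e (b x y)).
  rewrite (eq_bigr _ row) -natr_sum -big_distrr /=; congr ((_ * _)%N)%:R.
  by rewrite -sum_mem_pred.
rewrite exchange_big (eq_bigr _ col) -natr_sum -big_distrr /=; congr ((_ * _)%N)%:R.
exact: sum_mem_pred.
Qed.

(** If no [x] in [P] represented [psi], every sum over [Q] of [e (psi y - b x y)] would vanish.
    Summing over [P] first gives [#|P|] for each [y] in [Q] orthogonal to [P], where [psi] is 0, and
    0 for the others; the total is positive because of [y = 0]. *)
Lemma pairing_dual (psi : Y -> QZ) :
    {morph psi : y y' / y + y'} ->
    (forall y, y \in Q -> (forall x, x \in P -> b x y = 0) -> psi y = 0) ->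
  exists2 x, x \in P & forall y, y \in Q -> b x y = psi y.
Proof.
move=> psiD psi0.
case: (boolP [exists x in P, [forall y in Q, b x y == psi y]]) => [/exists_inP [x xP /forall_inP h]|].
  by exists x => // y /h /eqP.
rewrite negb_exists_in => /forall_inP hN; exfalso.
(* The values of [b] are killed by [#|X|] and those of [psi] by [#|Y|]; one root of unity has to
   serve both. *)
pose M := (N * #|Y|)%N.
have M0 : (0 < M)%N by rewrite muln_gt0 N0; apply/card_gt0P; exists 0.
have [z zP] := C_prim_root_exists M0.
pose e := qexp z M.
have psiT y : psi y *+ M = 0 by rewrite /M mulnC mulrnA qz_mulrn_card // mul0rn.
have bT x y : - b x y *+ M = 0 by rewrite mulNrn /M mulrnA b_tors mul0rn oppr0.
have eN u v : psi u - b v u = 0 -> b v u == psi u by move/eqP; rewrite subr_eq0 eq_sym.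
have S0 : \sum_(x in P) \sum_(y in Q) e (psi y - b x y) = 0.
  apply: big1 => x xP; have := hN x xP; rewrite negb_forall_in => /exists_inP [y yQ h].
  apply: (char_sum Qz _ yQ).
    move=> u v _ _; rewrite /e -qexpD ?mulrnDl ?psiT ?bT ?addr0 //.
    by rewrite psiD bDr opprD addrACA.
  rewrite qexp_eq1 ?mulrnDl ?psiT ?bT ?addr0 //.
  by apply: contra h => /eqP /eN.
move: S0; rewrite exchange_big.
rewrite (eq_bigr (fun y => (#|P| * [forall x in P, (b x y == 0)%R])%N%:R)); last first.
  move=> y yQ; case: (boolP [forall x in P, b x y == 0]) => [/forall_inP h|].
    rewrite muln1 (eq_bigr (fun=> 1)) ?sumr_const // => x xP.
    rewrite /e (eqP (h x xP)) psi0 ?subr0 ?qexp0 // => x' x'P.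
    exact/eqP/h.
  rewrite negb_forall_in => /exists_inP [x xP h].
  under eq_bigr => x' _ do rewrite /e qexpD //.
  rewrite -mulr_sumr (char_sum (chi := fun x => e (- b x y)) Pz _ xP) ?mulr0 ?muln0 //.
    by move=> u v _ _; rewrite /e bDl opprD qexpD.
  by rewrite qexp_eq1 // oppr_eq0.
have b0 x : b x 0 = 0 by apply: (addIr (b x 0)); rewrite -bDr !add0r.
rewrite -natr_sum (bigD1 0) /=; last by case: Qz.
have -> : [forall x in P, b x 0 == 0] by apply/forall_inP => x _; rewrite b0.
move/eqP; rewrite pnatr_eq0 muln1 addn_eq0 cards_eq0 => /andP [/eqP h _].
by case: Pz; rewrite h inE.
Qed.
End Pairing.

Section Adjoin.
Variables (A : finZmodType) (G : {set A}) (a : A).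
Hypothesis Gz : zmod_closed G.

(** The bound on [i] makes membership decidable; [adjoinP] removes it, as [#|A|] kills [A]. *)
Definition adjoin : {set A} := [set x | [exists i : 'I_#|A|, x - a *+ i \in G]].

Lemma adjoinP x : reflect (exists i : nat, x - a *+ i \in G) (x \in adjoin).
Proof.
rewrite inE; apply: (iffP existsP) => [[i h]|[i h]]; first by exists i.
have N0 : (0 < #|A|)%N by apply/card_gt0P; exists 0.
exists (Ordinal (ltn_pmod i N0)) => /=.
move: h; rewrite {1}(divn_eq i #|A|) mulrnDr mulnC mulrnA finzmod_card_mulrn.
by rewrite mul0rn add0r.
Qed.

Lemma adjoin_closed : zmod_closed adjoin.
Proof.
split=> [|x y /adjoinP [i hi] /adjoinP [j hj]]; apply/adjoinP.
  by exists 0%N; rewrite mulr0n subr0; case: Gz.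
(* Multiples are taken by natural numbers, so [#|A|.-1] plays the role of -1. *)
exists (i + j * #|A|.-1)%N.
have N0 : (0 < #|A|)%N by apply/card_gt0P; exists 0.
suff -> : x - y - a *+ (i + j * #|A|.-1) = (x - a *+ i) - (y - a *+ j).
  by case: Gz => _; apply.
have : a *+ (j + j * #|A|.-1) = 0.
  by rewrite -mulnS prednK // mulnC mulrnA finzmod_card_mulrn mul0rn.
rewrite mulrnDr => /eqP; rewrite addrC addr_eq0 => /eqP h.
by rewrite mulrnDr h !opprB addrACA [RHS]addrACA [- y + _]addrC.
Qed.

Lemma adjoin_sub : G \subset adjoin.
Proof. by apply/subsetP=> x xG; apply/adjoinP; exists 0%N; rewrite mulr0n subr0. Qed.

Lemma adjoin_gen : a \in adjoin.
Proof. by apply/adjoinP; exists 1%N; rewrite subrr; case: Gz. Qed.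

End Adjoin.

Section AltTheory.
Variables (A : finZmodType) (phi : A -> A -> QZ).
Hypothesis phi_alt : alternate phi.

Lemma altDl a b c : phi (a + b) c = phi a c + phi b c. Proof. by case: phi_alt. Qed.
Lemma altDr a b c : phi a (b + c) = phi a b + phi a c. Proof. by case: phi_alt. Qed.
Lemma altxx a : phi a a = 0. Proof. by case: phi_alt. Qed.
Lemma alt0x a : phi 0 a = 0. Proof. by apply: (addIr (phi 0 a)); rewrite -altDl !add0r. Qed.
Lemma altx0 a : phi a 0 = 0. Proof. by apply: (addIr (phi a 0)); rewrite -altDr !add0r. Qed.
Lemma altC a b : phi a b = - phi b a.
Proof.
apply/eqP; rewrite -addr_eq0.
by move: (altxx (a + b)); rewrite altDl !altDr !altxx add0r addr0 => ->.
Qed.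
Lemma altNl a b : phi (- a) b = - phi a b.
Proof. by apply/eqP; rewrite -addr_eq0 -altDl addNr alt0x. Qed.
Lemma altNr a b : phi a (- b) = - phi a b.
Proof. by rewrite altC altNl opprK altC. Qed.
Lemma altMl a b n : phi (a *+ n) b = phi a b *+ n.
Proof. by elim: n => [|n IH]; rewrite ?alt0x // !mulrS altDl IH. Qed.
Lemma altMr a b n : phi a (b *+ n) = phi a b *+ n.
Proof. by elim: n => [|n IH]; rewrite ?altx0 // !mulrS altDr IH. Qed.

Lemma radicalP a : reflect (forall b, phi a b = 0) (a \in radical phi).
Proof. by rewrite inE; apply: (iffP forallP) => h b; apply/eqP. Qed.

Lemma radical_closed : zmod_closed (radical phi).
Proof.
split=> [|x y /radicalP hx /radicalP hy]; apply/radicalP => b; first exact: alt0x.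
by rewrite altDl altNl hx hy subr0.
Qed.

(** A maximal isotropic subgroup contains everything orthogonal to it, since adjoining such an
    element keeps it isotropic. Its order comes from [pairing_card] applied to [A] and [L]. *)
Lemma lagrangian_exists : exists L : {set A},
  [/\ zmod_closed L, (forall a, a \in L <-> forall l, l \in L -> phi a l = 0) &
      (#|L| * #|L| = #|A| * #|radical phi|)%N].
Proof.
pose iso (L : {set A}) := [&& 0 \in L, [forall x in L, forall y in L, x - y \in L] &
  [forall x in L, forall y in L, phi x y == 0]].
have isoP (L : {set A}) : reflect (zmod_closed L /\ {in L &, forall x y, phi x y = 0}) (iso L).
  apply: (iffP and3P) => [[h0 /forall_inP h1 /forall_inP h2]|[[h0 h1] h2]].
    split; first by split=> // x y xL yL; move/forall_inP: (h1 x xL); apply.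
    by move=> x y xL yL; apply/eqP; move/forall_inP: (h2 x xL); apply.
  split=> //; first by apply/forall_inP => x xL; apply/forall_inP => y yL; apply: h1.
  by apply/forall_inP => x xL; apply/forall_inP => y yL; apply/eqP/h2.
have iso0 : iso [set 0].
  apply/isoP; split; last by move=> x y /set1P -> _; exact: alt0x.
  by split=> [|x y /set1P -> /set1P ->]; rewrite ?subr0; apply: set11.
have [L /maxsetP [/isoP [Lz Liso] Lmax] _] := maxset_exists iso0.
have LP a : reflect (forall l, l \in L -> phi a l = 0) (a \in L).
  apply: (iffP idP) => [aL l lL|h]; first exact: Liso.
  rewrite -(Lmax (adjoin L a)) ?adjoin_sub ?adjoin_gen //.
  apply/isoP; split; first exact: adjoin_closed.
  move=> x y /adjoinP [i hi] /adjoinP [j hj].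
  have h' l : l \in L -> phi l a = 0 by move=> lL; rewrite altC h // oppr0.
  rewrite -[x](subrK (a *+ i)) -[y](subrK (a *+ j)).
  move: (x - _) (y - _) hi hj => u v uL vL; rewrite altDl !altDr (Liso u v) //.
  by rewrite !altMl !altMr altxx h' // h // !mul0rn !addr0.
exists L; split=> //; first by move=> a; split=> /LP.
have := pairing_card altDl altDr (zmod_closedT A) Lz.
rewrite cardsT; set L1 := [set x in _ | _]; set K1 := [set x in _ | _].
have -> : L1 = L.
  apply/setP => x; rewrite inE in_setT /=; apply/idP/LP => [/forall_inP h l lL|h].
    exact/eqP/h.
  by apply/forall_inP => l lL; apply/eqP/h.
have -> // : K1 = radical phi.
apply/setP => x; rewrite inE; apply/andP/radicalP => [[_ /forall_inP h] c|h].
  by rewrite altC (eqP (h c _)) ?oppr0 ?in_setT.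
split; first by apply/LP => l _; apply: h.
by apply/forall_inP => c _; rewrite altC h oppr0.
Qed.

End AltTheory.

(** * Extension of characters *)

Lemma mulrn_order (A : finZmodType) (x : A) i : (x *+ i == 0) = (#[x]%g %| i)%N.
Proof. by rewrite order_dvdn FinRing.zmodXgE. Qed.

(** By minimality of [d], the Euclidean division of [m] by [d] leaves no remainder. *)
Lemma rel_order_dvd (A : finZmodType) (G : {set A}) (a : A) d m :
    zmod_closed G -> (0 < d)%N -> a *+ d \in G ->
    (forall i, (0 < i < d)%N -> a *+ i \notin G) -> a *+ m \in G -> (d %| m)%N.
Proof.
move=> Gz d0 hd dmin hm; rewrite /dvdn; apply: contraT => h.
have /negP [] : a *+ (m %% d) \notin G by apply: dmin; rewrite lt0n h ltn_mod.
have -> : a *+ (m %% d) = a *+ m - a *+ d *+ (m %/ d).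
  by rewrite -mulrnA mulnC [in X in X - _](divn_eq m d) mulrnDr addrC addKr.
by case: (Gz) => _; apply => //; apply: zmod_closed_mulrn.
Qed.

(** An element [g + a *+ i] with [g] in [G] has to go to [chi g + y *+ i]. Two choices of [i] differ
    by a multiple of [d], and [y *+ d = chi (a *+ d)] makes the value independent of the choice. *)
Lemma char_step (A : finZmodType) (G : {set A}) (chi : A -> QZ) a d y :
    zmod_closed G -> {in G &, {morph chi : x y / x + y}} ->
    (0 < d)%N -> a *+ d \in G -> (forall i, (0 < i < d)%N -> a *+ i \notin G) ->
    y *+ d = chi (a *+ d) ->
  exists chi' : A -> QZ, [/\ {in adjoin G a &, {morph chi' : x y / x + y}},
    {in G, chi' =1 chi} & chi' a = y].
Proof.
move=> Gz chiD d0 hd dmin hy.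
have uniq x i j : x - a *+ i \in G -> x - a *+ j \in G ->
    chi (x - a *+ i) + y *+ i = chi (x - a *+ j) + y *+ j.
  wlog le_ij : i j / (i <= j)%N.
    by move=> W; case/orP: (leq_total i j) => h hi hj; [|symmetry]; apply: W.
  move=> hi hj; have h : a *+ (j - i) \in G.
    have -> : a *+ (j - i) = (x - a *+ i) - (x - a *+ j).
      by rewrite opprB addrC subrKA mulrnBr.
    by case: Gz => _; apply.
  case/dvdnP: (rel_order_dvd Gz d0 hd dmin h) => q hq.
  have -> : x - a *+ i = (x - a *+ j) + a *+ d *+ q.
    by rewrite -mulrnA mulnC -hq mulrnBr // addrA subrK.
  have hdq : a *+ d *+ q \in G by exact: (zmod_closed_mulrn Gz).
  have E : chi (a *+ d *+ q) = chi (a *+ d) *+ q by exact: (add_in_mulrn Gz chiD).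
  rewrite (chiD (x - a *+ j)) // E -hy -mulrnA mulnC -hq.
  by rewrite -addrA -mulrnDr subnK.
(* The default 0 is only taken outside [adjoin G a]. *)
pose chi' x := if [pick i : 'I_#|A| | x - a *+ i \in G] is Some i
  then chi (x - a *+ i) + y *+ i else 0.
have chi'E x i : x - a *+ i \in G -> chi' x = chi (x - a *+ i) + y *+ i.
  move=> hi; rewrite /chi'; case: pickP => [j hj|h]; first exact: uniq.
  have : x \in adjoin G a by apply/adjoinP; exists i.
  by rewrite inE => /existsP [j]; rewrite h.
exists chi'; split.
- move=> u v /adjoinP [i hi] /adjoinP [j hj].
  have E : u + v - a *+ (i + j) = (u - a *+ i) + (v - a *+ j).
    by rewrite mulrnDr opprD addrACA.
  rewrite (chi'E _ _ hi) (chi'E _ _ hj) (chi'E _ (i + j)%N) E ?(chiD (u - a *+ i) (v - a *+ j)) //.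
    by rewrite mulrnDr addrACA.
  by rewrite (GRing.zmod_closedD Gz).2.
- by move=> x xG; rewrite (chi'E _ 0%N) ?subr0 // addr0.
- rewrite (chi'E _ 1%N) ?subrr; last by case: Gz.
  by rewrite (add_in0 Gz chiD) add0r.
Qed.

(** Elements are adjoined one at a time; the divisibility of Q/Z supplies the value at the new
    one. *)
Lemma char_extend (A : finZmodType) (G : {set A}) (chi : A -> QZ) :
    zmod_closed G -> {in G &, {morph chi : x y / x + y}} ->
  exists2 psi : A -> QZ, {morph psi : x y / x + y} & {in G, psi =1 chi}.
Proof.
have [k hk] := ubnP #|~: G|; elim: k G chi hk => // k IH G chi; rewrite ltnS => hk Gz chiD.
case: (boolP [exists a, a \notin G]) => [/existsP [a aG]|]; last first.
  rewrite negb_exists => /forallP h; have hG x : x \in G by have := h x; rewrite negbK.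
  by exists chi => // x y; apply: chiD.
have ex : exists d, (0 < d)%N && (a *+ d \in G).
  exists #|A|; rewrite finzmod_card_mulrn; case: (Gz) => -> _; rewrite andbT.
  by apply/card_gt0P; exists 0.
case: (ex_minnP ex) => d /andP [d0 hd] dmin.
have [y hy] := qz_divisible (chi (a *+ d)) d0.
have [i|chi' [chi'D chi'E _]] := char_step Gz chiD d0 hd _ hy.
  move=> /andP [i0 id]; apply/negP => hi; have := dmin i; rewrite i0 hi => /(_ isT).
  by rewrite leqNgt id.
have [| | |psi psiD psiE] := IH (adjoin G a) chi' => //.
- apply: leq_trans hk; apply: proper_card.
  rewrite properE !setCS adjoin_sub //=; apply/subsetPn; exists a => //.
  exact: adjoin_gen.
- exact: adjoin_closed.
exists psi => // x xG; rewrite psiE ?chi'E //; exact: (subsetP (adjoin_sub G a)).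
Qed.

(** Starting from the zero subgroup, the only constraint on the value at [x] is to be killed by the
    order of [x]. The resulting character is faithful on the group generated by [x]. *)
Lemma char_at_order (A : finZmodType) (x : A) :
  exists2 psi : A -> QZ, {morph psi : x y / x + y} & psi x = qz_of (1 / (#[x]%g)%:R).
Proof.
have z0 : zmod_closed [set 0 : A].
  by split=> [|u v /set1P -> /set1P ->]; rewrite ?subr0; apply: set11.
have := @char_step A [set 0] (fun=> 0) x #[x]%g (qz_of (1 / (#[x]%g)%:R)) z0.
case=> //.
- have -> : x *+ #[x]%g = 0 by apply/eqP; rewrite mulrn_order.
  exact: set11.
- move=> i /andP [i0 id]; apply: contraL id => h.
  have {h} : x *+ i == 0 by apply/eqP/set1P.
  rewrite mulrn_order => h.
  by rewrite -leqNgt dvdn_leq.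
- by rewrite -qz_of_frac_muln; apply/eqP; rewrite qz_of_frac_eq0.
move=> chi [chiD _ chix].
have [psi psiD psiE] := char_extend (adjoin_closed x z0) chiD.
by exists psi => //; rewrite psiE ?adjoin_gen.
Qed.

(** * Embedding into a nondegenerate module *)

(* The group generated by [A] and an element [w = (0, 1)] subject to [(d.+1) w = b]; the carry
   of the addition in [Z/(d.+1)] is sent to a multiple of [b]. *)
Definition cyc_ext (A : finZmodType) (b : A) (d : nat) := (A * 'I_d.+1)%type.

Section CycExt.
Variables (A : finZmodType) (b : A) (d : nat).
Local Notation T := (cyc_ext b d).

HB.instance Definition _ := Finite.on T.

Definition cyc_ext0 : T := (0, 0).
Definition cyc_ext_add (x y : T) : T := (x.1 + y.1 + b *+ ((x.2 + y.2) %/ d.+1), x.2 + y.2).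
(** For a nonzero index, the representatives of [i] and [- i] sum to [d.+1]; the term in [b] cancels
    the resulting carry. *)
Definition cyc_ext_opp (x : T) : T := (- x.1 - b *+ (x.2 != 0), - x.2).

Lemma cyc_ext_addC : commutative cyc_ext_add.
Proof. by move=> x y; rewrite /cyc_ext_add [x.1 + _]addrC [x.2 + _]addrC addnC. Qed.

Lemma carryA i j k D : (0 < D)%N ->
  ((i + j) %/ D + ((i + j) %% D + k) %/ D = (i + j + k) %/ D)%N.
Proof. by move=> D0; rewrite [in RHS](divn_eq (i + j) D) -addnA divnMDl. Qed.

Lemma carryAr i j k D : (0 < D)%N ->
  ((j + k) %/ D + (i + (j + k) %% D) %/ D = (i + j + k) %/ D)%N.
Proof. by move=> D0; rewrite [(i + _ %% _)%N]addnC carryA // addnC addnA. Qed.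

Lemma cyc_ext_addA : associative cyc_ext_add.
Proof.
move=> x y z; rewrite /cyc_ext_add /=; congr pair; last by rewrite addrA.
transitivity (x.1 + y.1 + z.1 + b *+ ((x.2 + y.2 + z.2) %/ d.+1)).
  by rewrite -carryAr // mulrnDr !addrA.
by rewrite -carryA // mulrnDr !addrA; congr (_ + _); rewrite addrAC.
Qed.

Lemma cyc_ext_add0 : left_id cyc_ext0 cyc_ext_add.
Proof.
move=> [x i]; rewrite /cyc_ext_add /= !add0r add0n divn_small ?ltn_ord //.
by rewrite mulr0n addr0.
Qed.

Lemma cyc_ext_addN : left_inverse cyc_ext0 cyc_ext_opp cyc_ext_add.
Proof.
move=> [x i]; rewrite /cyc_ext_add /= addNr; congr pair.
have -> : ((nat_of_ord (- i)%R + i) %/ d.+1)%N = (i != 0).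
  rewrite /=; case: (eqVneq i 0) => [->|i0]; first by rewrite subn0 modnn add0n div0n.
  have i0' : (0 < i)%N by rewrite lt0n.
  by rewrite modn_small ?ltn_subrL ?i0' // subnK ?divnn // ltnW.
by rewrite [- x - _]addrC subrK addNr.
Qed.

HB.instance Definition _ := GRing.isZmodule.Build T
  cyc_ext_addA cyc_ext_addC cyc_ext_add0 cyc_ext_addN.

End CycExt.

Lemma zmod_closed_group_set (A : finZmodType) (G : {set A}) : zmod_closed G -> group_set G.
Proof.
move=> Gz; apply/group_setP; split; first by case: Gz.
by move=> x y xG yG; rewrite (GRing.zmod_closedD Gz).2.
Qed.

(** A finite nilpotent group contains an element whose order is the exponent. *)
Lemma zmod_exponent (A : finZmodType) (G : {set A}) : zmod_closed G ->
  exists2 k, k \in G & forall x, x \in G -> x *+ #[k]%g = 0.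
Proof.
move=> Gz; pose H := Group (zmod_closed_group_set Gz).
have cH : abelian H by apply/centsP => x _ y _; apply: addrC.
have [k kH ek] := exponent_witness (abelian_nil cH).
exists k => // x xG; apply/eqP; rewrite mulrn_order -ek; exact: (@dvdn_exponent _ x H).
Qed.

(** The new generator w pairs with [a] to [psi a]. This respects the relation that [d.+1] times w is
    [b]: a carry contributes [phi b a], which is [psi a *+ d.+1], and [psi b = 0] matches the zero
    pairing of w with itself. *)
Lemma cyc_ext_alternate (A : finZmodType) (phi : A -> A -> QZ) (psi : A -> QZ) b d :
    alternate phi -> {morph psi : x y / x + y} -> psi b = 0 ->
    (forall a, phi b a = psi a *+ d.+1) ->
  alternate (fun u v : cyc_ext b d => phi u.1 v.1 + psi v.1 *+ u.2 - psi u.1 *+ v.2).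
Proof.
move=> phi_alt psiD psib phib.
pose f (u v : cyc_ext b d) := phi u.1 v.1 + psi v.1 *+ u.2 - psi u.1 *+ v.2.
have fC u v : f u v = - f v u.
  by rewrite /f (altC phi_alt u.1) !opprD opprK -!addrA [- _ + psi _ *+ _]addrC.
have fD u v w : f (u + v) w = f u w + f v w.
  have psi0 : psi 0 = 0 by apply: (addIr (psi 0)); rewrite -psiD !add0r.
  have psiM x n : psi (x *+ n) = psi x *+ n.
    by elim: n => [|n IH]; rewrite ?psi0 // !mulrS psiD IH.
  rewrite /f -[u + v]/(cyc_ext_add u v) /cyc_ext_add /= !(altDl phi_alt) (altMl phi_alt) phib.
  rewrite !psiD psiM psib mul0rn addr0 -mulrnA.
  have e : psi w.1 *+ (u.2 + v.2) =
      psi w.1 *+ (d.+1 * ((u.2 + v.2) %/ d.+1)) + psi w.1 *+ ((u.2 + v.2) %% d.+1).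
    by rewrite -mulrnDr [in LHS](divn_eq (u.2 + v.2) d.+1) mulnC.
  rewrite -(addrA _ _ (_ *+ (_ %% _))) -e mulrnDr mulrnDl opprD [RHS]addrACA.
  by congr (_ + _); rewrite addrACA.
split=> //.
- by move=> u v w; rewrite -/(f _ _) fC fD opprD -!fC.
- by move=> u; rewrite (altxx phi_alt) add0r subrr.
Qed.

(** The order of [k] is the exponent of the radical [K], and [psi] is faithful on the multiples of
    [k]. After adjoining an element that pairs through [psi], the radical shrinks to the kernel of
    [psi] on [K], a complement of the group generated by [k]. *)
Lemma radical_step (A : finZmodType) (phi : A -> A -> QZ) :
    alternate phi -> (1 < #|radical phi|)%N ->
  exists (W : finZmodType) (om : W -> W -> QZ) (i : A -> W),
    [/\ alternate om, {morph i : x y / x + y}, injective i,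
        (forall x y, om (i x) (i y) = phi x y) &
        (#|radical om| < #|radical phi|)%N /\
        (#|W| * #|radical om| = #|A| * #|radical phi|)%N].
Proof.
move=> phi_alt K1; set K := radical phi.
have Kz := radical_closed phi_alt.
have [k kK kexp] := zmod_exponent Kz.
have [psi psiD psik] := char_at_order k.
have psi0 : psi 0 = 0 by apply: (addIr (psi 0)); rewrite -psiD !add0r.
have psiM x n : psi (x *+ n) = psi x *+ n.
  by elim: n => [|n IH]; rewrite ?psi0 // !mulrS psiD IH.
have D0 : (0 < #[k]%g)%N := order_gt0 k.
have [d Dd] : exists d, #[k]%g = d.+1 by case: #[k]%g D0 => // d _; exists d.
have psiK x : x \in K -> psi x *+ d.+1 = 0 by move=> /kexp h; rewrite -psiM -Dd h.
(* The character [psi y *+ d.+1] vanishes on [K], the orthogonal of [A], so [pairing_dual]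
   represents it. *)
have [b0 _ hb0] : exists2 b, b \in [set: A] & forall y, y \in [set: A] -> phi b y = psi y *+ d.+1.
  apply: (@pairing_dual A A phi (altDl phi_alt) (altDr phi_alt) setT setT
    (zmod_closedT A) (zmod_closedT A) (fun y => psi y *+ d.+1)).
    by move=> x y; rewrite psiD mulrnDl.
  move=> y _ h; apply: psiK; apply/(radicalP) => c.
  by rewrite (altC phi_alt) h ?oppr0 ?in_setT.
(* [psi b0 *+ d.+1] is [phi b0 b0], which is 0; hence [psi b0] is a multiple of [psi k]. *)
have [j hj] : exists j : nat, psi b0 = psi k *+ j.
  have [||j ->] := @qz_torsionP (psi b0) d.+1 => //.
    by rewrite -hb0 ?in_setT // (altxx phi_alt).
  by exists j; rewrite psik Dd -qz_of_frac_muln.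
(* Subtracting a multiple of the radical element [k] leaves the pairing with [A] unchanged and kills
   [psi b]. *)
pose b := b0 - k *+ j.
have psib : psi b = 0.
  apply: (addIr (psi (k *+ j))); rewrite -psiD subrK add0r psiM //.
have phib a : phi b a = psi a *+ d.+1.
  rewrite /b (altDl phi_alt) (altNl phi_alt) (altMl phi_alt).
  by rewrite (elimT (radicalP phi k) kK) mul0rn subr0 hb0 ?in_setT.
pose om (u v : cyc_ext b d) := phi u.1 v.1 + psi v.1 *+ u.2 - psi u.1 *+ v.2.
have om_alt : alternate om by exact: cyc_ext_alternate.
(* Testing against [(k, 0)] kills the index, testing against [A] puts [u.1] in [K], and testing
   against the new generator gives [psi u.1 = 0]. *)
have radE u : u \in radical om -> [/\ u.1 \in K, u.2 = 0 & psi u.1 = 0].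
  move=> /radicalP h.
  have u20 : u.2 = 0.
    have := h (k, 0); rewrite /om /= mulr0n subr0 (altC phi_alt) (elimT (radicalP phi k) kK).
    rewrite oppr0 add0r psik Dd -qz_of_frac_muln => /eqP.
    rewrite qz_of_frac_eq0 // => /dvdnP [[|q] hq]; first exact: val_inj.
    by have := ltn_ord u.2; rewrite hq mulSn ltnNge leq_addr.
  have uK : u.1 \in K.
    by apply/radicalP => c; have := h (c, 0); rewrite /om /= u20 !mulr0n addr0 subr0.
  (* [inord 1] is the new generator only for positive [d]; for [d = 0] the claim is [psiK]
     itself. *)
  split=> //; have [d0|d0] := posnP d; first by move: (psiK _ uK); move: (psi _) => q; rewrite d0.
  have := h (0, inord 1); rewrite /om /= u20 (altx0 phi_alt) psi0 !mul0rn ?add0r ?sub0r.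
  by rewrite inordK // => /eqP; rewrite oppr_eq0 => /eqP.
have radI a : a \in K -> psi a = 0 -> ((a, 0) : cyc_ext b d) \in radical om.
  move=> /radicalP aK psia; apply/radicalP => v.
  by rewrite /om /= aK psia mulr0n mul0rn addr0 subr0.
(* Each element of [K] is uniquely [u + k *+ i] with [psi u = 0], the index [i] being read off from
   the value of [psi]. *)
have cardK : (#|radical om| * d.+1 = #|K|)%N.
  rewrite -[d.+1]card_ord -cardsT -cardsX.
  pose f (p : cyc_ext b d * 'I_d.+1) := p.1.1 + k *+ p.2.
  rewrite -(@card_in_imset _ _ f); last first.
    move=> [[u1 u2] i] [[v1 v2] i']; rewrite !in_setX /f.
    move=> /andP [/radE hu _] /andP [/radE hv _] e.
    move: hu hv e => /= [uK -> psiu] [vK -> psiv] e.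
    have ii : i = i'.
      apply/val_inj; have := congr1 psi e; rewrite !psiD !psiM psiu psiv !add0r psik Dd.
      rewrite -!qz_of_frac_muln => {}e.
      wlog le_ii : i i' e / (i <= i')%N.
        by move=> W; case/orP: (leq_total i i') => h; [|symmetry]; apply: W.
      apply/eqP; rewrite eqn_leq le_ii /=.
      have : qz_of ((i' - i)%:R / d.+1%:R) == 0.
        by rewrite natrB // mulrBl qz_ofD qz_ofN e subrr.
      rewrite qz_of_frac_eq0 // -subn_eq0; case: (posnP (i' - i)) => // h /dvdn_leq - /(_ h).
      by rewrite leqNgt (leq_ltn_trans (leq_subr _ _)).
    by move: e; rewrite ii => /addIr ->.
  congr #|pred_of_set _|; apply/setP => x; apply/imsetP/idP.
    case=> [[u i]]; rewrite in_setX => /andP [/radE [uK _ _] _] ->.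
    by rewrite /f (GRing.zmod_closedD Kz).2 ?(zmod_closed_mulrn Kz).
  move=> xK; have [i hi] : exists i : nat, psi x = psi k *+ i.
    have [||i ->] := @qz_torsionP (psi x) d.+1 => //; first exact: psiK.
    by exists i; rewrite psik Dd -qz_of_frac_muln.
  pose i' : 'I_d.+1 := inZp i.
  have hi' : psi x = psi k *+ i'.
    by rewrite hi psik Dd -!qz_of_frac_muln /= qz_of_frac_mod.
  exists ((x - k *+ i', 0), i'); last by rewrite /f /= subrK.
  rewrite in_setX in_setT andbT; apply: radI.
    by case: (Kz) => _; apply => //; apply: (zmod_closed_mulrn Kz).
  by apply: (addIr (psi (k *+ i'))); rewrite -psiD subrK add0r psiM.
exists (cyc_ext b d), om, (fun a => (a, 0)); split=> //.
- move=> x y; rewrite -[RHS]/(cyc_ext_add _ _) /cyc_ext_add /=.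
  by rewrite div0n mulr0n addr0 addr0.
- by move=> x y [].
- by move=> x y; rewrite /om /= !mulr0n addr0 subr0.
split.
  (* If [d] were 0, the exponent of [K] would be 1 and [K] trivial, against [K1]. *)
  rewrite -cardK ltn_Pmulr //.
    rewrite ltnS lt0n; apply/eqP => d0; move: K1; rewrite ltnNge => /negP []; rewrite (_ : radical phi = [set 0]) ?cards1 //.
    apply/setP => x; rewrite in_set1; apply/idP/eqP => [xK|->]; last by case: Kz.
    by have := kexp x xK; rewrite Dd d0 mulr1n.
  by apply/card_gt0P; exists 0; case: (radical_closed om_alt).
by rewrite card_prod card_ord -mulnA [(d.+1 * _)%N]mulnC cardK.
Qed.

(** [radical_step] is iterated until the radical is trivial. It preserves the product of the order
    of the module and that of its radical, which ends up as [#|W|]. *)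
Lemma symplectic_cover (A : finZmodType) (phi : A -> A -> QZ) : alternate phi ->
  exists (W : finZmodType) (om : W -> W -> QZ) (i : A -> W),
    [/\ alternate om, (forall w, (forall w', om w w' = 0) -> w = 0) &
        #|W| = (#|A| * #|radical phi|)%N] /\
    [/\ {morph i : x y / x + y}, injective i & forall x y, om (i x) (i y) = phi x y].
Proof.
have [k hk] := ubnP #|radical phi|; elim: k A phi hk => // k IH A phi hk phi_alt.
have [K1|K1] := ltnP 1 #|radical phi|.
  have [W [om [i [om_alt iD iinj iiso [ltK cK]]]]] := radical_step phi_alt K1.
  have [||W' [om' [i' [[h1 h2 h3] [h4 h5 h6]]]]] := IH W om; rewrite ?(leq_trans ltK) //.
  exists W', om', (i' \o i); split; first by split=> //; rewrite h3.
  by split=> [x y /=||x y /=]; rewrite ?iD ?h4 ?h6 //; apply: inj_comp.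
exists A, phi, id; split; split=> //.
  move=> w /radicalP wK; move: K1; rewrite leqNgt; apply: contraNeq => w0.
  rewrite (cardsD1 w) wK (cardsD1 0) in_setD1 eq_sym w0 /=.
  by case: (radical_closed phi_alt) => -> _.
have /eqP -> : #|radical phi| == 1%N; last by rewrite muln1.
by rewrite eqn_leq K1; apply/card_gt0P; exists 0; case: (radical_closed phi_alt).
Qed.

(** * Symplectic bases *)

Lemma mulrn_ordD (V : zmodType) (x : V) d (i j : 'I_d.+1) :
  x *+ d.+1 = 0 -> x *+ nat_of_ord (i + j)%R = x *+ i + x *+ j.
Proof.
move=> h; rewrite -mulrnDr [in RHS](divn_eq (i + j) d.+1) mulrnDr mulnC mulrnA h.
by rewrite mul0rn add0r.
Qed.

(** The numerator over [d.+1], read modulo [d.+1]; off the [d.+1]-torsion the values are junk. *)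
Definition qlog d (q : QZ) : 'I_d.+1 := inZp (Num.trunc (sval q *+ d.+1)).

Lemma qlogE d k : qlog d (qz_of (k%:R / d.+1%:R)) = inZp k.
Proof. by apply: val_inj; rewrite /= qz_of_frac_trunc // modn_mod. Qed.

Lemma qlogK d q : q *+ d.+1 = 0 -> q = qz_of (1 / d.+1%:R) *+ qlog d q.
Proof.
case/(qz_torsionP (ltn0Sn d)) => k ->.
by rewrite qlogE -qz_of_frac_muln /= qz_of_frac_mod.
Qed.

Lemma qlogD d p q : p *+ d.+1 = 0 -> q *+ d.+1 = 0 -> qlog d (p + q) = qlog d p + qlog d q.
Proof.
case/(qz_torsionP (ltn0Sn d)) => k ->; case/(qz_torsionP (ltn0Sn d)) => l ->.
by rewrite -qz_of_fracD !qlogE; apply: val_inj; rewrite /= modnDm.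
Qed.

(** A hyperbolic pair [x], [y] is split off, with [x] of maximal order [d.+1] and [om x y] of the
    same order, and the induction continues on its orthogonal [S']. Working with subsets of a fixed
    [W] avoids a new type for each complement. *)
Lemma symplectic_split (W : finZmodType) (om : W -> W -> QZ) (S : {set W}) :
    alternate om -> zmod_closed S ->
    (forall x, x \in S -> (forall y, y \in S -> om x y = 0) -> x = 0) ->
  exists (B : finZmodType) (eb : W -> B) (ef : W -> B -> QZ),
   [/\ (#|B| * #|B|)%N = #|S|, {in S &, {morph eb : a a' / a + a'}},
      (forall a, a \in S -> {morph ef a : x y / x + y}),
      {in S &, forall a a' x, ef (a + a') x = ef a x + ef a' x} &
      {in S &, forall a a', om a a' = ef a' (eb a) - ef a (eb a')}].
Proof.
move=> om_alt.
have [k hk] := ubnP #|S|; elim: k S hk => // k IH S; rewrite ltnS => hk Sz Snd.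
have [x xS xexp] := zmod_exponent Sz.
have S0 : 0 \in S by case: Sz.
have [d Dd] : exists d, #[x]%g = d.+1.
  by case: #[x]%g (order_gt0 x) => // d _; exists d.
have Sd s : s \in S -> s *+ d.+1 = 0 by rewrite -Dd; apply: xexp.
have [d0|d0] := posnP d.
  have S1 s : s \in S -> s = 0 by move/Sd; rewrite d0 mulr1n.
  exists 'I_1, (fun=> 0), (fun _ _ => 0).
  split=> [||a _ u v|a a' _ _ u|a a' /S1 -> _]; rewrite ?addr0 ?(alt0x om_alt) ?subr0 //.
  - rewrite card_ord muln1; apply/esym/eqP/cards1P; exists 0; apply/setP => s.
    by rewrite in_set1; apply/idP/eqP => [/S1|->].
  - by move=> a a' _ _; rewrite addr0.
have [psi psiD psix] := char_at_order x.
have z0 : zmod_closed [set 0 : W].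
  by split=> [|u v /set1P -> /set1P ->]; rewrite ?subr0; apply: set11.
(* By nondegeneracy, only 0 among the multiples of [x] is orthogonal to [S], so [pairing_dual]
   realizes [psi] on them by an element of [S]. *)
have [y yS hy] : exists2 y, y \in S & forall q, q \in adjoin [set 0] x -> om q y = psi q.
  apply: (@pairing_dual W W (fun s q => om q s)) => //.
  - by move=> u v w; rewrite (altDr om_alt).
  - by move=> u v w; rewrite (altDl om_alt).
  - exact: adjoin_closed.
  move=> q /adjoinP [i /set1P /eqP]; rewrite subr_eq0 => /eqP -> h.
  rewrite (Snd _ _ h) ?(zmod_closed_mulrn Sz) //.
  by apply: (addIr (psi 0)); rewrite -psiD !add0r.
have {psi psiD psix hy} xy : om x y = qz_of (1 / d.+1%:R).
  by rewrite hy ?psix ?Dd // adjoin_gen.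
have oxd s : s \in S -> om x s *+ d.+1 = 0 by move=> sS; rewrite -(altMl om_alt) Sd // (alt0x om_alt).
have oyd s : om s y *+ d.+1 = 0 by rewrite -(altMr om_alt) Sd // (altx0 om_alt).
(* The coordinates of [s] along [x] and [y], each read off by pairing with the other one; [pr s]
   below is the remainder, orthogonal to both when [s] is in [S]. *)
pose al s := qlog d (om s y); pose be s := qlog d (om x s).
have alE s : om s y = om x y *+ al s by rewrite xy -qlogK.
have beE s : s \in S -> om x s = om x y *+ be s by move=> sS; rewrite xy -qlogK // oxd.
pose S' : {set W} := [set s in S | (om x s == 0) && (om y s == 0)].
have S'P s : reflect [/\ s \in S, om x s = 0 & om y s = 0] (s \in S').
  by rewrite inE; apply: (iffP and3P) => -[h1 h2 h3]; split=> //; apply/eqP.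
have S'z : zmod_closed S'.
  split=> [|u v /S'P [u1 u2 u3] /S'P [v1 v2 v3]]; apply/S'P.
    by rewrite !(altx0 om_alt).
  rewrite !(altDr om_alt) !(altNr om_alt) u2 u3 v2 v3 subr0; split=> //.
  by case: Sz => _; apply.
pose pr s := s - x *+ al s - y *+ be s.
have prE s : s = pr s + x *+ al s + y *+ be s by rewrite /pr addrAC !subrK.
have SB u v : u \in S -> v \in S -> u - v \in S by case: Sz => _; apply.
have prS s : s \in S -> pr s \in S'.
  move=> sS; apply/S'P; split.
  - by rewrite /pr !SB // (zmod_closed_mulrn Sz).
  - rewrite /pr !(altDr om_alt) !(altNr om_alt) !(altMr om_alt) (altxx om_alt).
    by rewrite mul0rn subr0 -beE // subrr.
  - rewrite /pr !(altDr om_alt) !(altNr om_alt) !(altMr om_alt) (altxx om_alt).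
    rewrite mul0rn subr0 [om y s](altC om_alt) [om y x](altC om_alt) mulNrn opprK.
    by rewrite -alE addNr.
have S'nd t : t \in S' -> (forall t', t' \in S' -> om t t' = 0) -> t = 0.
  move=> /S'P [tS tx ty] h; apply: Snd => // s sS.
  rewrite (prE s); move: (pr s) (prS s sS) => u uS'; rewrite !(altDr om_alt) h //.
  rewrite !(altMr om_alt) [om t x](altC om_alt) [om t y](altC om_alt) tx ty oppr0.
  by rewrite !mul0rn !addr0.
have cardS : #|S| = (#|S'| * (d.+1 * d.+1))%N.
  rewrite -[d.+1]card_ord -cardsT -!cardsX.
  pose f (p : W * ('I_d.+1 * 'I_d.+1)) := p.1 + x *+ p.2.1 + y *+ p.2.2.
  have fxy u i j : (u, (i, j)) \in setX S' (setX [set: 'I_d.+1] [set: 'I_d.+1]) ->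
      om (f (u, (i, j))) y = om x y *+ i /\ om x (f (u, (i, j))) = om x y *+ j.
    rewrite in_setX => /andP [/S'P /= [uS ux uy] _].
    rewrite /f /= !(altDl om_alt) !(altDr om_alt) !(altMl om_alt) !(altMr om_alt).
    by rewrite !(altxx om_alt) [om u y](altC om_alt) ux uy oppr0 !mul0rn !add0r addr0.
  have qi (i j : 'I_d.+1) : om x y *+ i = om x y *+ j -> i = j.
    rewrite xy -!qz_of_frac_muln => /(congr1 (qlog d)); rewrite !qlogE.
    by move/(congr1 val); rewrite /= !modn_small // => /val_inj.
  rewrite -(@card_in_imset _ _ f); last first.
    move=> [u [i j]] [v [i' j']] hu hv e.
    have [a1 b1] := fxy _ _ _ hu; have [a2 b2] := fxy _ _ _ hv.
    move: a1 b1; rewrite e a2 b2 => /qi ii /qi jj.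
    by move: e; rewrite ii jj /f /= => /addIr /addIr ->.
  congr #|pred_of_set _|; apply/setP => s; apply/idP/imsetP.
    move=> sS; exists (pr s, (al s, be s)); last exact: prE.
    by rewrite !in_setX !in_setT prS.
  case=> [[u [i j]]]; rewrite in_setX => /andP [/S'P [uS _ _] _] ->.
  by rewrite /f /= !(GRing.zmod_closedD Sz).2 ?(zmod_closed_mulrn Sz).
have S'0 : (0 < #|S'|)%N by apply/card_gt0P; exists 0; case: S'z.
have [] := IH S' _ S'z S'nd.
  apply: leq_trans hk; rewrite cardS ltn_Pmulr // -[1%N]/(1 * 1)%N.
  by rewrite ltn_mul.
move=> B' [eb' [ef' [cB ebD efDr efDl efom]]].
pose B : finZmodType := HB.pack ('I_d.+1 * B')%type.
have alD : {morph al : s t / s + t} by move=> s t; rewrite /al (altDl om_alt) qlogD.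
have beD : {in S &, {morph be : s t / s + t}}.
  by move=> s t sS tS; rewrite /be (altDr om_alt) qlogD ?oxd.
have prD : {in S &, {morph pr : s t / s + t}}.
  move=> s t sS tS; rewrite /pr alD beD // !mulrn_ordD ?Sd // !opprD.
  by rewrite [s + t + _]addrACA [LHS]addrACA.
(* The [x]-coordinate goes to the new cyclic factor of [B]; the [y]-coordinate, in the form
   [om x s], becomes a character of that factor. *)
exists B, (fun s => (al s, eb' (pr s)) : B), 
  (fun s (c : 'I_d.+1 * B') => om x s *+ c.1 + ef' (pr s) c.2).
split=> [|||a a' aS a'S c|a a' aS a'S].
- by rewrite card_prod card_ord mulnACA cB mulnC -cardS.
- by move=> a a' aS a'S /=; rewrite alD prD // ebD ?prS.
- move=> a aS [i c] [j c'] /=; rewrite mulrn_ordD ?oxd // (efDr _ (prS _ aS)).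
  by rewrite addrACA.
- by rewrite /= (altDr om_alt) mulrnDl prD // efDl ?prS // addrACA.
rewrite -[RHS]/(om x a' *+ al a + ef' (pr a') (eb' (pr a)) -
  (om x a *+ al a' + ef' (pr a) (eb' (pr a')))).
rewrite [in LHS](prE a) 2!(altDl om_alt) !(altMl om_alt) [om y a'](altC om_alt) (alE a').
have -> : om (pr a) a' = om (pr a) (pr a').
  have /S'P [_ px py] := prS _ aS.
  rewrite [in LHS](prE a'); move: (pr a) (pr a') px py => u v px py.
  rewrite !(altDr om_alt) !(altMr om_alt).
  by rewrite (altC om_alt _ x) (altC om_alt _ y) px py oppr0 !mul0rn !addr0.
rewrite mulNrn mulrnAC -(beE a) // efom ?prS //.
by rewrite -[LHS]addrA [LHS]addrC opprD [RHS]addrACA.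
Qed.

Lemma symplectic_BBstar (W : finZmodType) (om : W -> W -> QZ) :
    alternate om -> (forall x, (forall y, om x y = 0) -> x = 0) ->
  exists B : finZmodType, (#|B| * #|B|)%N = #|W| /\ isometric_embedding_BBstar om B.
Proof.
move=> om_alt nd.
have [|B [eb [ef [cB h1 h2 h3 h4]]]] := symplectic_split om_alt (zmod_closedT W).
  by move=> x _ h; apply: nd => y; apply: h; rewrite in_setT.
exists B; split; first by rewrite cB cardsT.
exists eb, ef; split.
- by move=> a; apply: h2; rewrite in_setT.
- by move=> a a'; apply: h1; rewrite in_setT.
- by move=> a a' x; apply: h3; rewrite in_setT.
- move=> a a' he hf; apply/eqP; rewrite -subr_eq0; apply/eqP/nd => c.
  by rewrite (altDl om_alt) (altNl om_alt) !h4 ?in_setT // he hf subrr.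
- by move=> a a'; apply: h4; rewrite in_setT.
Qed.

(** With [n = r * m], a cyclic factor of order [r] carrying the zero form multiplies both the order
    and the radical by [r], so the nondegenerate cover has order m^2 r^2 = n^2. *)
Lemma lagr_symplectic_cover (A : finZmodType) (phi : A -> A -> QZ) n :
    (0 < n)%N -> alternate phi -> lagr_order_dvd phi n ->
  exists (W B : finZmodType) (om : W -> W -> QZ) (i : A -> W),
    [/\ alternate om, (forall w, (forall w', om w w' = 0) -> w = 0) & #|W| = (n ^ 2)%N] /\
    [/\ {morph i : x y / x + y}, injective i, (forall x y, om (i x) (i y) = phi x y),
        #|B| = n & isometric_embedding_BBstar om B].
Proof.
move=> n0 phi_alt [m [mm /dvdnP [r nr]]].
have [r' rr'] : exists r', r = r'.+1.
  by case: r nr => [|r' _]; [move: n0 => /[swap] ->|exists r'].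
pose A2 : finZmodType := HB.pack (A * 'I_r'.+1)%type.
pose phi2 (u v : A2) := phi u.1 v.1.
have phi2_alt : alternate phi2.
  split=> [u v w|u v w|u]; rewrite /phi2 /=.
  - by rewrite (altDl phi_alt).
  - by rewrite (altDr phi_alt).
  - by rewrite (altxx phi_alt).
have rad2 : #|radical phi2| = (#|radical phi| * r'.+1)%N.
  rewrite -[r'.+1]card_ord -cardsT -cardsX; congr #|pred_of_set _|.
  apply/setP => -[a j]; rewrite in_setX in_setT andbT.
  apply/radicalP/radicalP => h c; first exact: (h (c, 0)).
  exact: h.
have [W [om [i [[om_alt nd cW] [iD iinj iiso]]]]] := symplectic_cover phi2_alt.
have cW2 : #|W| = (n ^ 2)%N.
  rewrite cW rad2 card_prod card_ord mulnACA -mm nr rr' expnMn -!mulnn; ring.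
have [B [cB emb]] := symplectic_BBstar om_alt nd.
exists W, B, om, (fun a => i (a, 0)); split=> //; split=> //.
- by move=> x y; rewrite -iD; congr (i (_, _)); rewrite addr0.
- by move=> x y /iinj [].
- by apply/eqP; rewrite -(@eqn_exp2r _ _ 2) // -cW2 -cB mulnn.
Qed.

(** * Linear algebra *)

Section LinearAlgebra.
Variable F : fieldType.

(** In a rank factorization [E = C R], idempotence forces [R C] to be the identity matrix of size
    the rank, and [C R] and [R C] have the same trace. *)
Lemma mxtrace_idem n (E : 'M[F]_n) : E *m E = E -> \tr E = (\rank E)%:R.
Proof.
move=> EE; rewrite -{1}(mulmx_base E) mxtrace_mulC.
suff -> : row_base E *m col_base E = 1%:M by rewrite mxtrace1.
have : (col_base E *m row_base E) *m (col_base E *m row_base E) = col_base E *m row_base E.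
  by rewrite !mulmx_base.
move: (col_base E) (row_base E) (col_base_full E) (row_base_free E).
move=> c b /row_fullP [C hC] bf /(congr1 (mulmx C)).
by rewrite !mulmxA hC !mul1mx -[RHS]mul1mx => /(row_free_inj bf).
Qed.

Lemma mulmx_sandwich_neq0 m n p q (A : 'M[F]_(m, n)) (B : 'M[F]_(p, q)) :
  A != 0 -> B != 0 -> exists M, A *m M *m B != 0.
Proof.
move=> /matrix0Pn [i [j Aij]] /matrix0Pn [k [l Bkl]].
(* This elementary matrix connects a nonzero entry of [A] to a nonzero entry of [B]. *)
exists (delta_mx j k); apply/matrix0Pn; exists i, l.
rewrite !mxE (bigD1 k) //= big1 => [|k' kk']; last first.
  rewrite mxE big1 ?mul0r // => j' _.
  by rewrite mxE (negPf kk') andbF mulr0.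
rewrite addr0 mxE (bigD1 j) //= big1 => [|j' jj']; last first.
  by rewrite mxE (negPf jj') mulr0.
by rewrite mxE !eqxx mulr1 addr0 mulf_neq0.
Qed.

(** Some matrix carries a given nonzero row of [U] to any prescribed row. *)
Lemma transitive_stable_full n (U : 'M[F]_n) :
  (forall M : 'M[F]_n, (U *m M <= U)%MS) -> U = 0 \/ row_full U.
Proof.
move=> h; have [->|U0] := eqVneq U 0; [by left|right].
have v0 : nz_row U != 0 by rewrite nz_row_eq0.
have vU : (nz_row U <= U)%MS by exact: nz_row_sub.
have vf : row_free (nz_row U) by rewrite /row_free rank_rV v0.
rewrite -sub1mx; apply/row_subP => i.
apply: submx_trans (h (pinvmx (nz_row U) *m row i 1%:M)).
by rewrite -[X in (X <= _)%MS]mul1mx -(mulmxVp vf) -mulmxA submxMr.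
Qed.

(** The trace against [invmx (f j)] isolates [n] times the coefficient of [f j], so the family is
    linearly independent in a space of dimension n^2. *)
Lemma orth_family_free n (n0 : (n%:R : F) != 0) (I : finType) (f : I -> 'M[F]_n) :
    (forall i, f i \in unitmx) -> (forall i j, i != j -> \tr (f i *m invmx (f j)) = 0) ->
  (#|I| <= n ^ 2)%N /\
  (#|I| = (n ^ 2)%N -> forall M, exists x : I -> F, M = \sum_i x i *: f i).
Proof.
move=> fU ftr.
pose N := \matrix_(i < #|I|) mxvec (f (enum_val i)).
have NE (u : 'rV_#|I|) : u *m N = mxvec (\sum_i u 0 i *: f (enum_val i)).
  rewrite linear_sum mulmx_sum_row; apply: eq_bigr => i _.
  by rewrite rowK linearZ.
have Nf : row_free N.
  apply/inj_row_free => u; rewrite NE => /(congr1 vec_mx); rewrite mxvecK linear0 => hu.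
  apply/rowP => j; rewrite mxE.
  have := congr1 (fun M => \tr (M *m invmx (f (enum_val j)))) hu.
  rewrite mul0mx mxtrace0 mulmx_suml raddf_sum /= (bigD1 j) //= big1 => [|i ij].
    rewrite addr0 -scalemxAl mulmxV ?fU // mxtraceZ mxtrace1 => /eqP.
    by rewrite mulf_eq0 (negPf n0) orbF => /eqP.
  by rewrite -scalemxAl mxtraceZ ftr ?mulr0 // (inj_eq enum_val_inj).
have rN : \rank N = #|I| by apply/eqP.
split=> [|cI M]; first by rewrite -rN -mulnn rank_leq_col.
have : (mxvec M <= N)%MS by rewrite submx_full // /row_full rN cI mulnn.
case/submxP => u hu; exists (fun i => u 0 (enum_rank i)).
rewrite -[M]mxvecK hu NE mxvecK [RHS](reindex (fun i : 'I_#|I| => enum_val i)) /=.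
  by apply: eq_bigr => i _; rewrite enum_valK.
by apply: onW_bij; exact: enum_val_bij.
Qed.

Lemma mxvec_lin_ext m n p (A B : 'M[F]_(m * n, p)) :
  (forall X : 'M[F]_(m, n), mxvec X *m A = mxvec X *m B) -> A = B.
Proof.
move=> h; apply/row_matrixP => i; rewrite !rowE.
by rewrite -[delta_mx 0 i]vec_mxK h.
Qed.

End LinearAlgebra.

(** * Common eigenvectors over an algebraically closed field *)

Section ClosedField.
Variable F : closedFieldType.

Lemma root_exists n (a : F) : (0 < n)%N -> exists x, x ^+ n = a.
Proof.
move=> n0; have [x hx] := @solve_monicpoly F n (fun i => if i == 0%N then a else 0) n0.
exists x; rewrite hx; case: n n0 {hx} => // n _.
rewrite big_ord_recl /= mulr1 big1 ?addr0 // => i _.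
by rewrite mul0r.
Qed.

Lemma scale_det1 n (M : 'M[F]_n) : (0 < n)%N -> M \in unitmx ->
  exists2 c : F, c != 0 & \det (c *: M) = 1.
Proof.
move=> n0; rewrite unitmxE unitfE => dM.
have [x hx] := root_exists (\det M)^-1 n0.
exists x; last by rewrite detZ hx mulVf.
by apply: contra_eq_neq hx => ->; rewrite expr0n eqn0Ngt n0 eq_sym invr_eq0.
Qed.

Lemma closed_eigenvalue n (A : 'M[F]_n) : (0 < n)%N -> exists a, eigenvalue A a.
Proof.
move=> n0; have /closed_rootP [a ha] : size (char_poly A) != 1%N.
  by rewrite size_char_poly; case: (n) n0.
by exists a; rewrite eigenvalue_root_char.
Qed.

Lemma stable_eigenvector m n (V : 'M[F]_(m, n)) (A : 'M[F]_n) :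
  V != 0 -> stablemx V A -> exists2 v : 'rV_n, v != 0 & (v <= V)%MS /\ exists a, v *m A = a *: v.
Proof.
move=> V0 VA; have r0 : (0 < \rank V)%N by rewrite lt0n mxrank_eq0.
have /submxP [M hM] : (row_base V *m A <= row_base V)%MS.
  by rewrite eq_row_base (eqmxMr A (eq_row_base V)).
have [a /eigenvalueP [u hu u0]] := closed_eigenvalue M r0.
exists (u *m row_base V); first by rewrite mulmx_free_eq0 ?row_base_free.
split; first by rewrite (submx_trans (submxMl _ _)) ?eq_row_base.
by exists a; rewrite -mulmxA hM mulmxA hu scalemxAl.
Qed.

(** The part of [V] in an eigenspace of the first matrix is stable under the others, which commute
    with it. *)
Lemma common_eigenvector_seq m n (V : 'M[F]_(m, n)) (As : seq 'M[F]_n) :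
    V != 0 -> {in As &, forall A B, A *m B = B *m A} -> {in As, forall A, stablemx V A} ->
  exists2 v : 'rV_n, v != 0 & (v <= V)%MS /\ {in As, forall A, exists a, v *m A = a *: v}.
Proof.
elim: As m V => [|A As IH] m V V0 cA sA.
  by exists (nz_row V); rewrite ?nz_row_eq0 //; split=> //; exact: nz_row_sub.
have [v v0 [vV [a va]]] := stable_eigenvector V0 (sA A (mem_head _ _)).
have W0 : (V :&: eigenspace A a)%MS != 0.
  apply: contraNneq v0 => W0; rewrite -submx0 -W0 sub_capmx vV.
  by apply/eigenspaceP.
have [||u u0 [uW hu]] := IH _ _ W0.
- by move=> B C hB hC; apply: cA; rewrite inE ?hB ?hC orbT.
- move=> B hB; have BA : B \in A :: As by rewrite inE hB orbT.
  rewrite sub_capmx; apply/andP; split.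
    by rewrite (submx_trans (submxMr _ (capmxSl _ _))) // sA.
  apply: (submx_trans (submxMr _ (capmxSr _ _))).
  apply: comm_mx_stable_eigenspace; exact: cA (mem_head _ _) BA.
move: uW; rewrite sub_capmx => /andP [uV /eigenspaceP ua].
exists u => //; split=> // B; rewrite inE => /predU1P [->|]; last exact: hu.
by exists a.
Qed.

Lemma common_eigenvector_fam m n (V : 'M[F]_(m, n)) (I : finType) (f : I -> 'M[F]_n) :
    V != 0 -> (forall i j, f i *m f j = f j *m f i) -> (forall i, stablemx V (f i)) ->
  exists2 v : 'rV_n, v != 0 & (v <= V)%MS /\ exists k : I -> F, forall i, v *m f i = k i *: v.
Proof.
move=> V0 cf sf.
have [||v v0 [vV hv]] := @common_eigenvector_seq m n V (codom f) V0.
- by move=> _ _ /codomP [i ->] /codomP [j ->].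
- by move=> _ /codomP [i ->].
exists v => //; split=> //.
apply: (@fin_all_exists I (fun=> F) (fun i a => v *m f i = a *: v)) => i.
by apply: hv; exact: codom_f.
Qed.

End ClosedField.

(** * Trace-zero projective representations *)

(* The trace condition stands in for irreducibility: it makes the [s a] linearly independent. *)
Definition weyl (F : fieldType) n (xi : F) (A : finZmodType) (phi : A -> A -> QZ)
    (s : A -> 'M[F]_n) : Prop :=
  [/\ (forall a, s a \in unitmx),
      (forall a b, exists c : F, s a *m s b = c *: s (a + b)),
      (forall a b, s a *m s b = qexp xi n (phi a b) *: (s b *m s a)) &
      (forall a, a != 0 -> \tr (s a) = 0)].

Section Weyl.
Variables (F : closedFieldType) (n : nat) (xi : F).
Hypotheses (charF0 : [pchar F] =i pred0) (n_gt0 : (0 < n)%N) (xi_prim : n.-primitive_root xi).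

Lemma natF_eq0 k : (k%:R == 0 :> F) = (k == 0)%N.
Proof. exact: (pcharf0P F).1. Qed.

Lemma natF_neq0 k : (0 < k)%N -> k%:R != 0 :> F.
Proof. by rewrite natF_eq0 lt0n. Qed.

Lemma natF_inj k l : k%:R = l%:R :> F -> k = l.
Proof.
wlog kl : k l / (k <= l)%N.
  by move=> W; case/orP: (leq_total k l) => h e; [|symmetry]; apply: W.
move=> e; apply/eqP; rewrite eqn_leq kl -subn_eq0 -natF_eq0 natrB // e subrr eqxx //.
Qed.

Let nF : n%:R != 0 :> F := natF_neq0 n_gt0.

Lemma unitmx_scale_inj (M : 'M[F]_n) c d : M \in unitmx -> c *: M = d *: M -> c = d.
Proof.
move=> MU /(congr1 (fun X => \tr (X *m invmx M))).
by rewrite -!scalemxAl mulmxV // !mxtraceZ mxtrace1 => /(mulIf nF).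
Qed.

Lemma unitmx_neq0 (M : 'M[F]_n) : M \in unitmx -> M != 0.
Proof.
move=> MU; apply/eqP => M0; have := unitmx_scale_inj (c := 1) (d := 0) MU.
by rewrite M0 !scaler0 => /(_ erefl) /eqP; rewrite oner_eq0.
Qed.

Lemma unitmx_mul_neq0 (M N : 'M[F]_n) c K : M \in unitmx -> N \in unitmx ->
  M *m N = c *: K -> c != 0.
Proof.
move=> MU NU e; apply/eqP => c0; have : M *m N \in unitmx by rewrite unitmx_mul MU.
by rewrite e c0 scale0r => /unitmx_neq0; rewrite eqxx.
Qed.

Section Theory.
Variables (A : finZmodType) (phi : A -> A -> QZ) (s : A -> 'M[F]_n).
Hypothesis (sW : weyl xi phi s).

Lemma weyl_unit a : s a \in unitmx. Proof. by case: sW. Qed.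
Lemma weyl_mul a b : exists2 c : F, c != 0 & s a *m s b = c *: s (a + b).
Proof.
case: sW => h1 /(_ a b) [c hc] _ _; exists c => //.
exact: unitmx_mul_neq0 hc.
Qed.
Lemma weyl_comm a b : s a *m s b = qexp xi n (phi a b) *: (s b *m s a). Proof. by case: sW. Qed.
Lemma weyl_tr a : a != 0 -> \tr (s a) = 0. Proof. by case: sW => _ _ _; apply. Qed.

Lemma weyl0 : exists2 c : F, c != 0 & s 0 = c%:M.
Proof.
have [c c0 hc] := weyl_mul 0 0; exists c => //.
rewrite addr0 in hc; apply: (row_free_inj (A := s 0)); first by rewrite row_free_unit weyl_unit.
by rewrite hc mul_scalar_mx.
Qed.

Lemma weyl_inv a : exists2 c : F, c != 0 & invmx (s a) = c *: s (- a).
Proof.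
have [c c0 hc] := weyl_mul (- a) a; have [d d0 hd] := weyl0.
exists ((c * d)^-1); first by rewrite invr_eq0 mulf_neq0.
apply: (row_free_inj (A := s a)); first by rewrite row_free_unit weyl_unit.
rewrite mulVmx ?weyl_unit // -scalemxAl hc addNr hd scale_scalar_mx.
by rewrite scale_scalar_mx mulVf // mulf_neq0.
Qed.

Lemma weyl_tr_orth a b : a != b -> \tr (s a *m invmx (s b)) = 0.
Proof.
move=> ab; have [c _ ->] := weyl_inv b; have [d _ hd] := weyl_mul a (- b).
by rewrite -scalemxAr hd !mxtraceZ weyl_tr ?mulr0 // subr_eq0.
Qed.

Lemma weyl_span : #|A| = (n ^ 2)%N -> forall M, exists x : A -> F, M = \sum_a x a *: s a.
Proof. exact: (orth_family_free nF weyl_unit weyl_tr_orth).2. Qed.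

(** The n^2 matrices [s a] span all matrices, so a subspace stable under them is stable under every
    matrix. *)
Lemma weyl_stable_full (U : 'M[F]_n) : #|A| = (n ^ 2)%N ->
  (forall a, (U *m s a <= U)%MS) -> U = 0 \/ row_full U.
Proof.
move=> cA h; apply: transitive_stable_full => M.
have [x ->] := weyl_span cA M.
rewrite mulmx_sumr summx_sub // => a _.
by rewrite -scalemxAr scalemx_sub.
Qed.

End Theory.

Lemma weyl_scale (A : finZmodType) (phi : A -> A -> QZ) (s : A -> 'M[F]_n) (mu : A -> F) :
  (forall a, mu a != 0) -> weyl xi phi s -> weyl xi phi (fun a => mu a *: s a).
Proof.
move=> mu0 w; split=> [a|a b|a b|a a0].
- by rewrite unitmxZ ?unitfE ?mu0 // (weyl_unit w).
- have [c _ hc] := weyl_mul w a b; exists (mu a * mu b * c / mu (a + b)).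
  by rewrite -scalemxAl -scalemxAr hc !scalerA divfK.
- by rewrite -!scalemxAl -!scalemxAr (weyl_comm w) !scalerA; congr (_ *: _); ring.
- by rewrite mxtraceZ (weyl_tr w) ?mulr0.
Qed.

Section LagrangianProjector.
Variables (A : finZmodType) (L : {set A}) (kap : A -> F) (s : A -> 'M[F]_n).
Hypotheses (Lz : zmod_closed L) (kap0 : forall l, l \in L -> kap l != 0).
Hypothesis sU : forall l, l \in L -> s l \in unitmx.
Hypothesis sM : {in L &, forall l l', s l *m s l' = (kap l * kap l' / kap (l + l')) *: s (l + l')}.

(** By [sM] the matrices [(kap l)^-1 *: s l] form a representation of [L]; this is its averaging
    projector onto the invariants. *)
Definition lproj : 'M[F]_n := (#|L|%:R)^-1 *: \sum_(l in L) (kap l)^-1 *: s l.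

Let L0 : 0 \in L. Proof. by case: Lz. Qed.
Let LD x y : x \in L -> y \in L -> x + y \in L.
Proof. by move=> xL yL; rewrite (GRing.zmod_closedD Lz).2. Qed.
Let LB x y : x \in L -> y \in L -> x - y \in L.
Proof. by case: Lz => _; apply. Qed.
Let Lcard : (0 < #|L|)%N.
Proof. by apply/card_gt0P; exists 0. Qed.

Lemma lproj_l l : l \in L -> s l *m lproj = kap l *: lproj.
Proof.
move=> lL; rewrite /lproj -scalemxAr scalerA mulrC -scalerA; congr (_ *: _).
rewrite mulmx_sumr scaler_sumr [RHS](reindex_inj (addrI l)) /=.
apply: eq_big => [l'|l' l'L].
  by apply/idP/idP => [|h]; [exact: LD|rewrite -[l'](addKr l) addrC LB].
rewrite -scalemxAr sM // !scalerA; congr (_ *: _).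
by rewrite mulrC -mulrA -[RHS]mul1r -(mulfV (kap0 l'L)); ring.
Qed.

Lemma lproj_r l : l \in L -> lproj *m s l = kap l *: lproj.
Proof.
move=> lL; rewrite -(lproj_l lL) /lproj -scalemxAr -scalemxAl; congr (_ *: _).
rewrite mulmx_suml mulmx_sumr; apply: eq_bigr => l' l'L.
rewrite -scalemxAl -scalemxAr; congr (_ *: _).
by rewrite !sM // (addrC l') (mulrC (kap l')).
Qed.

Lemma lproj_idem : lproj *m lproj = lproj.
Proof.
rewrite {1}/lproj -scalemxAl mulmx_suml (eq_bigr (fun=> lproj)); last first.
  by move=> l lL; rewrite -scalemxAl lproj_l // scalerA mulVf ?scale1r ?kap0.
by rewrite sumr_const -scaler_nat scalerA mulVf ?scale1r // natF_neq0.
Qed.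

Lemma lproj0 : s 0 = (kap 0)%:M.
Proof.
have := sM L0 L0; rewrite addr0 mulfK ?kap0 // => h.
apply: (row_free_inj (A := s 0)); first by rewrite row_free_unit sU.
by rewrite h mul_scalar_mx.
Qed.

Lemma lproj_tr : (forall l, l \in L -> l != 0 -> \tr (s l) = 0) ->
  \tr lproj = n%:R / #|L|%:R.
Proof.
move=> h; rewrite /lproj mxtraceZ raddf_sum /= (bigD1 0) //= big1 => [|l /andP [lL l0]].
  by rewrite addr0 mxtraceZ lproj0 mxtrace_scalar -(mulr_natr (kap 0)) (mulrA (kap 0)^-1) mulVf ?kap0 // mul1r mulrC.
by rewrite mxtraceZ h ?mulr0.
Qed.

Lemma lproj_fix m (v : 'M[F]_(m, n)) : (forall l, l \in L -> v *m s l = kap l *: v) -> v *m lproj = v.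
Proof.
move=> h; rewrite /lproj -scalemxAr mulmx_sumr (eq_bigr (fun=> v)); last first.
  by move=> l lL; rewrite -scalemxAr h // scalerA mulVf ?scale1r ?kap0.
by rewrite sumr_const -scaler_nat scalerA mulVf ?scale1r // natF_neq0.
Qed.

End LagrangianProjector.

(* A common eigenvector [v] of the commuting matrices [s l] gives the character [kap] by which
   [s] restricted to [L] differs from a homomorphism. *)
Lemma lagr_char (A : finZmodType) (phi : A -> A -> QZ) s (L : {set A}) (P : 'M[F]_n) :
    weyl xi phi s -> zmod_closed L -> {in L &, forall x y, phi x y = 0} ->
    P != 0 -> (forall l, l \in L -> s l *m P = P *m s l) ->
  exists kap : A -> F, [/\ (forall l, l \in L -> kap l != 0),
    {in L &, forall l l', s l *m s l' = (kap l * kap l' / kap (l + l')) *: s (l + l')} &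
    P *m lproj L kap s != 0].
Proof.
move=> sW Lz Liso P0 Ps.
pose f l := if l \in L then s l else 1%:M.
have [i j|i|v v0 [vP [kap hk]]] := common_eigenvector_fam (f := f) P0.
- rewrite /f; case: ifP => iL; case: ifP => jL; rewrite ?mulmx1 ?mul1mx //.
  by rewrite (weyl_comm sW) Liso // qexp0 // scale1r.
- by rewrite /f; case: ifP => iL; rewrite ?mulmx1 // -Ps // submxMl.
have hs l : l \in L -> v *m s l = kap l *: v by move=> lL; have := hk l; rewrite /f lL.
have kap0 l : l \in L -> kap l != 0.
  move=> lL; apply: contraNneq v0 => k0; have := hs l lL; rewrite k0 scale0r.
  by move/(congr1 (mulmx^~ (invmx (s l)))); rewrite mulmxK ?(weyl_unit sW) // mul0mx => ->.
exists kap; split=> //; last first.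
  have vE := lproj_fix Lz kap0 hs; case/submxP: vP => D hD.
  apply: contraNneq v0 => h; rewrite -vE hD -mulmxA h mulmx0 //.
move=> l l' lL l'L; have [c c0 hc] := weyl_mul sW l l'; rewrite hc; congr (_ *: _).
have llL : l + l' \in L by rewrite (GRing.zmod_closedD Lz).2.
have e : (kap l * kap l') *: v = (c * kap (l + l')) *: v.
  transitivity (v *m (s l *m s l')).
    by rewrite mulmxA hs // -scalemxAl hs // scalerA.
  by rewrite hc -scalemxAr hs // scalerA.
have {}e : kap l * kap l' = c * kap (l + l').
  apply/eqP; rewrite -subr_eq0; apply: contraNT v0 => h.
  move/eqP: e; rewrite -subr_eq0 -scalerBl scaler_eq0 (negPf h) //.
by rewrite e mulfK // kap0.
Qed.

Lemma weyl_lagr_order (A : finZmodType) (phi : A -> A -> QZ) (s : A -> 'M[F]_n) :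
  alternate phi -> weyl xi phi s -> lagr_order_dvd phi n.
Proof.
move=> phi_alt sW; have [L [Lz LP cL]] := lagrangian_exists phi_alt.
exists #|L|; split=> //.
have Liso : {in L &, forall x y, phi x y = 0} by move=> x y /LP h /h.
have one0 : 1%:M != 0 :> 'M[F]_n by apply: unitmx_neq0; rewrite unitmx1.
have [|kap [kap0 sM _]] := lagr_char sW Lz Liso one0.
  by move=> l _; rewrite mulmx1 mul1mx.
have sU l : l \in L -> s l \in unitmx by move=> _; exact: weyl_unit sW l.
have := lproj_tr Lz kap0 sU sM (fun l _ => @weyl_tr _ _ _ sW l).
rewrite (mxtrace_idem (lproj_idem Lz kap0 sM)) => e.
have Lcard : #|L|%:R != 0 :> F.
  by apply: natF_neq0; apply/card_gt0P; exists 0; case: Lz.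
have : (\rank (lproj L kap s) * #|L|)%:R = n%:R :> F by rewrite natrM e divfK.
by move/natF_inj => <-; rewrite dvdn_mull.
Qed.
End Weyl.

(** * Projective equivalence *)

Lemma invmxM (F : fieldType) n (A B : 'M[F]_n) : A \in unitmx -> B \in unitmx ->
  invmx (A *m B) = invmx B *m invmx A.
Proof.
move=> AU BU; have ABU : A *m B \in unitmx by rewrite unitmx_mul AU.
apply: (row_free_inj (A := A *m B)); first by rewrite row_free_unit.
by rewrite /= mulVmx // mulmxA mulmxKV // mulVmx.
Qed.

Section Intertwiner.
Variables (F : closedFieldType) (n : nat) (xi : F).
Hypotheses (charF0 : [pchar F] =i pred0) (n_gt0 : (0 < n)%N) (xi_prim : n.-primitive_root xi).
Variables (A : finZmodType) (phi : A -> A -> QZ).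
Hypotheses (phi_alt : alternate phi) (phi_tors : forall a b, phi a b *+ n = 0).

(** The scalar [c] is unique when [s1 (a + b)] is invertible, so for [weyl] families this is
    equality of the multipliers, stated without naming them. *)
Definition same_cocycle (s1 s2 : A -> 'M[F]_n) : Prop :=
  forall a b c, s1 a *m s1 b = c *: s1 (a + b) -> s2 a *m s2 b = c *: s2 (a + b).

Lemma same_cocycle_sym s1 s2 : weyl xi phi s1 -> weyl xi phi s2 ->
  same_cocycle s1 s2 -> same_cocycle s2 s1.
Proof.
move=> w1 w2 h a b c e; have [d _ hd] := weyl_mul charF0 n_gt0 w1 a b.
have := h _ _ _ hd; rewrite e => /(unitmx_scale_inj charF0 n_gt0 (weyl_unit w2 _)) ->.
by [].
Qed.

(* A common eigenvector of the commuting operators [X |-> (s1 a)^-1 X (s2 a)] provides the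
   rescaling of [s2]. *)
Lemma weyl_cocycle_match (s1 s2 : A -> 'M[F]_n) : weyl xi phi s1 -> weyl xi phi s2 ->
  exists mu : A -> F, [/\ forall a, mu a != 0, weyl xi phi (fun a => mu a *: s2 a) &
    same_cocycle s1 (fun a => mu a *: s2 a)].
Proof.
move=> w1 w2; have u1 := weyl_unit w1; have u2 := weyl_unit w2.
pose op a : 'M[F]_(n * n) := lin_mx (mulmx (invmx (s1 a)) \o mulmxr (s2 a)).
have opE a X : mxvec X *m op a = mxvec (invmx (s1 a) *m X *m s2 a).
  by rewrite mul_vec_lin /= mulmxA.
have one0 : 1%:M != 0 :> 'M[F]_(n * n).
  apply/eqP => /(congr1 (fun M : 'M[F]_(n * n) => \tr M)); rewrite mxtrace1 mxtrace0 => /eqP.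
  by rewrite natF_eq0 // muln_eq0 eqn0Ngt n_gt0.
have [a b|a|v v0 [_ [lam hlam]]] := common_eigenvector_fam (f := op) one0.
(* The commutator scalar of [s2 a] and [s2 b] cancels against that of the inverses of [s1 a] and
   [s1 b], so the operators commute. *)
- apply: mxvec_lin_ext => X; rewrite !mulmxA !opE; congr mxvec.
  have := weyl_comm w1 a b; have := weyl_comm w2 a b.
  set q := qexp _ _ _ => e2 e1.
  have q0 : q != 0.
    by apply: (unitmx_mul_neq0 charF0 n_gt0 (u1 a) (u1 b)); exact: e1.
  have e1' : invmx (s1 b) *m invmx (s1 a) = q^-1 *: (invmx (s1 a) *m invmx (s1 b)).
    by rewrite -[LHS]invmxM // e1 invmxZ ?invmxM // -e1 unitmx_mul u1 u1.
  rewrite -!mulmxA e2 (mulmxA (invmx (s1 b))) e1' -!scalemxAr -scalemxAl scalerA.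
  by rewrite mulfV // scale1r !mulmxA.
- by rewrite mul1mx submx1.
pose X := vec_mx v.
have X0 : X != 0 by rewrite -(inj_eq (can_inj mxvecK)) vec_mxK linear0.
have hX a : X *m s2 a = lam a *: (s1 a *m X).
  have := hlam a; rewrite -[v]vec_mxK -/X opE -linearZ => /(can_inj mxvecK) e.
  by rewrite scalemxAr -e !mulmxA mulmxV ?mul1mx.
have lam0 a : lam a != 0.
  apply: contraNneq X0 => l0; have := hX a; rewrite l0 scale0r.
  by move/(congr1 (mulmx^~ (invmx (s2 a)))); rewrite mulmxK // mul0mx => ->.
pose s a := (lam a)^-1 *: s2 a.
have hs a : X *m s a = s1 a *m X by rewrite -scalemxAr hX scalerA mulVf ?scale1r.
have lamV0 a : (lam a)^-1 != 0 by rewrite invr_eq0.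
have sw : weyl xi phi s by exact: (weyl_scale charF0 n_gt0).
exists (fun a => (lam a)^-1); split=> // a b c hc; have [d _ hd] := weyl_mul charF0 n_gt0 sw a b.
(* [X] need not be invertible: being nonzero suffices to compare the two scalars. *)
suff dc : d = c by rewrite -dc.
have e : (d - c) *: (X *m s (a + b)) = 0.
  apply/eqP; rewrite scalerBl subr_eq0; apply/eqP.
  rewrite scalemxAr -hd (hs (a + b)) scalemxAl -hc mulmxA (hs a).
  by rewrite -(mulmxA (s1 a)) (hs b) mulmxA.
apply/eqP; rewrite -subr_eq0; move/eqP: e; rewrite scaler_eq0 => /orP [//|/eqP].
move/(congr1 (mulmx^~ (invmx (s (a + b))))); rewrite mulmxK ?(weyl_unit sw) // mul0mx.
by move/eqP; rewrite (negPf X0).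
Qed.

Definition avg (s1 s2 : A -> 'M[F]_n) (X : 'M[F]_n) : 'M[F]_n :=
  \sum_a invmx (s1 a) *m X *m s2 a.

(** After the sum is reindexed by [a + b], the cocycle scalar occurs once from [s2] and once
    inverted from [s1], and cancels. *)
Lemma avg_intertwines s1 s2 X : weyl xi phi s1 -> weyl xi phi s2 -> same_cocycle s1 s2 ->
  forall b, s1 b *m avg s1 s2 X = avg s1 s2 X *m s2 b.
Proof.
move=> w1 w2 h b; rewrite /avg mulmx_sumr mulmx_suml (reindex_inj (addIr b)) /=.
apply: eq_bigr => a _; have [c c0 hc] := weyl_mul charF0 n_gt0 w1 a b.
have e1 : s1 (a + b) = c^-1 *: (s1 a *m s1 b) by rewrite hc scalerA mulVf ?scale1r.
have e2 : s2 (a + b) = c^-1 *: (s2 a *m s2 b) by rewrite (h _ _ _ hc) scalerA mulVf ?scale1r.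
have ci : c^-1 != 0 by rewrite invr_eq0.
rewrite e1 e2 invmxZ ?unitmxZ ?unitmx_mul ?unitfE ?(weyl_unit w1) //.
rewrite invmxM ?(weyl_unit w1) // invrK !(=^~ scalemxAl, =^~ scalemxAr) scalerA mulfV //.
by rewrite scale1r !mulmxA mulmxV ?mul1mx // (weyl_unit w1).
Qed.

Lemma commutes_inv (M P : 'M[F]_n) : M \in unitmx -> M *m P = P *m M ->
  invmx M *m P = P *m invmx M.
Proof.
move=> MU e; have := congr1 (fun X => invmx M *m X *m invmx M) e.
by rewrite !mulmxA mulVmx // mul1mx mulmxK.
Qed.

(** The same [kap] serves for [s1] and [s2]. The idempotents [P1 *m e1] and [P2 *m e2] have equal
    trace, hence equal rank, so the second is nonzero along with the first. A nonzero [X] between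
    them is averaged to [Z], and [e1 *m Z *m e2] is [#|L|] times [X]. *)
Lemma partial_intertwiner s1 s2 (P1 P2 : 'M[F]_n) (L : {set A}) :
    weyl xi phi s1 -> weyl xi phi s2 -> same_cocycle s1 s2 ->
    zmod_closed L -> (forall a, a \in L <-> forall l, l \in L -> phi a l = 0) ->
    P1 != 0 -> P1 *m P1 = P1 -> P2 *m P2 = P2 ->
    (forall a, s1 a *m P1 = P1 *m s1 a) -> (forall a, s2 a *m P2 = P2 *m s2 a) ->
    (forall a, \tr (P1 *m s1 a) = \tr (P2 *m s2 a)) ->
  exists Z, [/\ Z != 0, P1 *m Z = Z, Z *m P2 = Z & forall a, s1 a *m Z = Z *m s2 a].
Proof.
move=> w1 w2 co Lz LP P10 P1i P2i P1c P2c Ptr.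
have u1 := weyl_unit w1; have u2 := weyl_unit w2.
have Liso : {in L &, forall x y, phi x y = 0} by move=> x y /LP h /h.
have [|kap [kap0 sM1 Pe0]] := lagr_char charF0 n_gt0 xi_prim w1 Lz Liso P10.
  by move=> l _; exact: P1c.
have sM2 : {in L &, forall l l', s2 l *m s2 l' = (kap l * kap l' / kap (l + l')) *: s2 (l + l')}.
  by move=> l l' lL l'L; apply: co; exact: sM1.
set e1 := lproj L kap s1 in Pe0; pose e2 := lproj L kap s2.
have comme (s : A -> 'M[F]_n) P : (forall a, s a *m P = P *m s a) ->
    lproj L kap s *m P = P *m lproj L kap s.
  move=> h; rewrite /lproj -scalemxAl -scalemxAr mulmx_suml mulmx_sumr; congr (_ *: _).
  by apply: eq_bigr => l _; rewrite -scalemxAl -scalemxAr h.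
have e1P : e1 *m P1 = P1 *m e1 by exact: comme.
have e2P : e2 *m P2 = P2 *m e2 by exact: comme.
have tre : \tr (P1 *m e1) = \tr (P2 *m e2).
  rewrite /e1 /e2 /lproj -!scalemxAr !mulmx_sumr !mxtraceZ !raddf_sum /=; congr (_ * _).
  by apply: eq_bigr => l _; rewrite -!scalemxAr !mxtraceZ Ptr.
have e1i : e1 *m e1 = e1 by exact: lproj_idem charF0 _ _ _ _ Lz kap0 sM1.
have e2i : e2 *m e2 = e2 by exact: lproj_idem charF0 _ _ _ _ Lz kap0 sM2.
have Pe1i : P1 *m e1 *m (P1 *m e1) = P1 *m e1.
  by rewrite mulmxA -(mulmxA P1 e1) e1P mulmxA P1i -mulmxA e1i.
have Pe2i : P2 *m e2 *m (P2 *m e2) = P2 *m e2.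
  by rewrite mulmxA -(mulmxA P2 e2) e2P mulmxA P2i -mulmxA e2i.
have Pe20 : P2 *m e2 != 0.
  apply: contraNneq Pe0 => h; rewrite -mxrank_eq0 -(natF_eq0 charF0) -mxtrace_idem // tre h.
  by rewrite mxtrace0.
have e1l l : l \in L -> s1 l *m e1 = kap l *: e1 by exact: lproj_l.
have e1r l : l \in L -> e1 *m s1 l = kap l *: e1 by exact: lproj_r.
have e2r l : l \in L -> e2 *m s2 l = kap l *: e2 by exact: lproj_r.
clear tre; clearbody e1 e2.
have [M hM] := mulmx_sandwich_neq0 Pe0 Pe20.
have [X [X0 e1X Xe2 P1X XP2]] : exists X, [/\ X != 0, e1 *m X = X, X *m e2 = X,
    P1 *m X = X & X *m P2 = X].
  exists (P1 *m e1 *m M *m (P2 *m e2)); split=> //.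
  - by rewrite !mulmxA e1P -!(mulmxA P1) e1i.
  - by rewrite -!mulmxA e2i.
  - by rewrite !mulmxA P1i.
  - by rewrite -!mulmxA e2P (mulmxA P2) P2i.
(* [e1 (s1 a)^-1 e1 = 0] for [a] outside [L] because [L] is its own orthogonal, so only [L]
   contributes to [e1 Z e2]. *)
pose Z := avg s1 s2 X.
have Zc : forall a, s1 a *m Z = Z *m s2 a by exact: avg_intertwines.
have P1V a : P1 *m invmx (s1 a) = invmx (s1 a) *m P1 by rewrite commutes_inv.
exists Z; split=> //.
- suff e : e1 *m Z *m e2 = #|L|%:R *: X.
    apply: contraNneq X0 => Z0; move/eqP: e; rewrite Z0 mulmx0 mul0mx eq_sym scaler_eq0.
    by rewrite (negPf (natF_neq0 charF0 _)) //; apply/card_gt0P; exists 0; case: Lz.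
  rewrite /Z /avg mulmx_sumr mulmx_suml (bigID (mem L)) /= [X in _ + X]big1 ?addr0.
    rewrite (eq_bigr (fun=> X)) ?sumr_const ?scaler_nat // => l lL.
    have ve : e1 *m invmx (s1 l) = (kap l)^-1 *: e1.
      have := e1r l lL => /(congr1 (mulmx^~ (invmx (s1 l)))) /=.
      rewrite mulmxK // -scalemxAl => e.
      by rewrite [in RHS]e scalerA mulVf ?scale1r ?kap0.
    rewrite !mulmxA ve -!scalemxAl e1X -{1}Xe2 -!mulmxA (mulmxA e2) (e2r l lL).
    by rewrite -scalemxAl -!scalemxAr e2i Xe2 scalerA mulVf ?kap0 // scale1r.
  move=> a aL; have [l lL al0] : exists2 l, l \in L & phi a l != 0.
    apply/exists_inP.
    apply: contraNT aL => /exists_inPn h; apply/LP => l lL.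
    by have := h l lL; rewrite negbK => /eqP.
  suff e0 : e1 *m invmx (s1 a) *m e1 = 0.
    by rewrite -e1X !mulmxA e0 !mul0mx.
  set q := qexp xi n (phi a l).
  have q1 : q != 1 by rewrite qexp_eq1.
  have eq : s1 l *m invmx (s1 a) = q *: (invmx (s1 a) *m s1 l).
    have := weyl_comm w1 a l => /(congr1 (fun X => invmx (s1 a) *m X *m invmx (s1 a))) /=.
    rewrite !mulmxA mulVmx // mul1mx => ->.
    by rewrite -!scalemxAr -scalemxAl !mulmxA mulmxK.
  (* [e1] absorbs [s1 l] from either side with the same factor [kap l], while moving [s1 l] past the
     inverse of [s1 a] costs [q]. *)
  have e : kap l *: (e1 *m invmx (s1 a) *m e1) = (q * kap l) *: (e1 *m invmx (s1 a) *m e1).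
    transitivity (e1 *m s1 l *m invmx (s1 a) *m e1).
      by rewrite (e1r l lL) -!scalemxAl.
    rewrite -(mulmxA e1) eq -!scalemxAr -!scalemxAl -!mulmxA (e1l l lL).
    by rewrite -!scalemxAr scalerA.
  move/eqP: e; rewrite -subr_eq0 -scalerBl scaler_eq0 => /orP [|/eqP //].
  rewrite -{1}[kap l]mul1r -mulrBl mulf_eq0 (negPf (kap0 _ lL)) orbF subr_eq0 eq_sym.
  by rewrite (negPf q1).
- rewrite /Z /avg mulmx_sumr; apply: eq_bigr => a _.
  by rewrite !mulmxA P1V -(mulmxA _ P1) P1X.
- rewrite /Z /avg mulmx_suml; apply: eq_bigr => a _.
  by rewrite -(mulmxA _ (s2 a)) P2c mulmxA -(mulmxA _ X) XP2.
Qed.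

(* An intertwiner of rank less than [n] can be enlarged by a nonzero one from its kernel to a
   complement of its image. *)
Lemma intertwiner_same_cocycle s1 s2 : weyl xi phi s1 -> weyl xi phi s2 -> same_cocycle s1 s2 ->
  exists2 T : 'M[F]_n, T \in unitmx & forall a, s1 a *m T = T *m s2 a.
Proof.
move=> w1 w2 co; have [L [Lz LP _]] := lagrangian_exists phi_alt.
have u1 := weyl_unit w1; have u2 := weyl_unit w2.
suff H k : (k <= n)%N -> exists2 T : 'M[F]_n, (k <= \rank T)%N & forall a, s1 a *m T = T *m s2 a.
  have [T hT Tc] := H n (leqnn n); exists T => //.
  by rewrite -row_free_unit /row_free eqn_leq rank_leq_row hT.
elim: k => [|k IH] hk; first by exists 0 => // a; rewrite mulmx0 mul0mx.
have [T hT Tc] := IH (ltnW hk).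
have [|Tlt] := ltnP k (\rank T); first by exists T.
have A0 : #|A|%:R != 0 :> F by apply: natF_neq0 => //; apply/card_gt0P; exists 0.
(* A generalized inverse of [T], averaged over [A], yields an intertwiner [Y] that is still a
   generalized inverse. *)
have [T' TT] : exists T', T *m T' *m T = T by exists (pinvmx T); rewrite mulmxKpV.
pose Y := (#|A|%:R)^-1 *: avg s2 s1 T'.
have Yc a : s2 a *m Y = Y *m s1 a.
  by rewrite -scalemxAr -scalemxAl avg_intertwines //; exact: same_cocycle_sym co.
have TYT : T *m Y *m T = T.
  rewrite /Y -scalemxAr -scalemxAl /avg mulmx_sumr mulmx_suml (eq_bigr (fun=> T)).
    by rewrite sumr_const -scaler_nat scalerA mulVf ?scale1r.
  move=> a _; have Tci : T *m invmx (s2 a) = invmx (s1 a) *m T.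
    have := Tc a => /(congr1 (fun X => invmx (s1 a) *m X *m invmx (s2 a))) /=.
    by rewrite !mulmxA mulVmx // mul1mx mulmxK // => ->.
  rewrite !mulmxA Tci -(mulmxA _ (s1 a)) Tc mulmxA.
  rewrite -(mulmxA _ T T') -(mulmxA _ (T *m T')) TT.
  by rewrite -mulmxA -Tc mulmxA mulVmx // mul1mx.
(* On row vectors, [P1] projects onto the kernel of [T] and [P2] onto a complement of its image. *)
pose P1 := 1%:M - T *m Y; pose P2 := 1%:M - Y *m T.
have P1T : P1 *m T = 0 by rewrite mulmxBl mul1mx TYT subrr.
have TP2 : T *m P2 = 0 by rewrite mulmxBr mulmx1 mulmxA TYT subrr.
have [||||||Z [Z0 P1Z ZP2 Zc]] := @partial_intertwiner s1 s2 P1 P2 L w1 w2 co Lz LP.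
- apply/eqP => P10; move: Tlt; rewrite leqNgt => /negP []; apply: leq_trans hk _.
  have /mulmx1_unit [Tu _] : T *m Y = 1%:M by move/eqP: P10; rewrite subr_eq0 => /eqP.
  by rewrite mxrank_unit.
- by rewrite {2}/P1 mulmxBr mulmx1 mulmxA P1T mul0mx subr0.
- by rewrite {1}/P2 mulmxBl mul1mx -mulmxA TP2 mulmx0 subr0.
- by move=> a; rewrite mulmxBr mulmxBl mulmx1 mul1mx mulmxA Tc -mulmxA Yc mulmxA.
- by move=> a; rewrite mulmxBr mulmxBl mulmx1 mul1mx mulmxA Yc -mulmxA Tc mulmxA.
(* The terms with [T *m Y] and [Y *m T] agree by cyclicity of the trace. The traces of [s1 a] and
   [s2 a] vanish off 0; at 0 both matrices are scalar, and equal cocycles make the scalars equal. *)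
- move=> a; rewrite !mulmxBl !mul1mx !raddfB /=; congr (_ - _); last first.
    by rewrite -mulmxA -Yc mulmxA mxtrace_mulC mulmxA.
  have [->|a0] := eqVneq a 0; last by rewrite (weyl_tr w1 a0) (weyl_tr w2 a0).
  have [c c0 hc] := weyl0 charF0 n_gt0 w1; have [d d0 hd] := weyl0 charF0 n_gt0 w2.
  rewrite hc hd; congr (\tr (_%:M)).
  have : s1 0 *m s1 0 = c *: s1 (0 + 0) by rewrite addr0 {1}hc mul_scalar_mx.
  move/co; rewrite addr0 {1}hd mul_scalar_mx => e.
  by apply/esym/(unitmx_scale_inj charF0 n_gt0 (u2 0)).
exists (T + Z); last by move=> a; rewrite mulmxDr mulmxDl Tc Zc.
have TYZ : T *m Y *m Z = 0.
  have : P1 *m Z = Z by []; rewrite mulmxBl mul1mx => /eqP; rewrite subr_eq addrC -subr_eq subrr.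
  by rewrite eq_sym => /eqP.
(* Multiplying [T + Z] on the left by [T *m Y] recovers [T]. If the rank had not grown, [Z] would
   lie in the row space of [T], which [P2] kills. *)
have TS : (T <= (T + Z)%R)%MS.
  by apply/submxP; exists (T *m Y); rewrite mulmxDr TYT TYZ addr0.
rewrite ltnNge; apply: contra Z0 => hr.
have TZ : ((T + Z)%R <= T)%MS.
  have /eqmxP -> // : (T == (T + Z)%R)%MS.
  by rewrite -(geq_leqif (mxrank_leqif_eq TS)) (leq_trans hr).
have : (Z <= T)%MS by rewrite -[Z](addKr T) addmx_sub // eqmx_opp.
by case/submxP => D hD; rewrite -ZP2 hD -mulmxA TP2 mulmx0.
Qed.

Lemma intertwiner_exists s1 s2 : weyl xi phi s1 -> weyl xi phi s2 ->
  exists2 T : 'M[F]_n, T \in unitmx & forall a, exists c, s1 a *m T = c *: (T *m s2 a).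
Proof.
move=> w1 w2; have [mu [mu0 w2' co]] := weyl_cocycle_match w1 w2.
have [T TU hT] := intertwiner_same_cocycle w1 w2' co.
by exists T => // a; exists (mu a); rewrite hT scalemxAr.
Qed.

End Intertwiner.

(** * Centralizers of irreducible subgroups *)

Section Projective.
Variables (F : closedFieldType) (n : nat) (xi : F).
Hypotheses (charF0 : [pchar F] =i pred0) (n_gt0 : (0 < n)%N) (xi_prim : n.-primitive_root xi).

Lemma weyl_normalize (A : finZmodType) (phi : A -> A -> QZ) (s : A -> 'M[F]_n) :
    weyl xi phi s ->
  exists mu : A -> F, [/\ forall a, mu a != 0, weyl xi phi (fun a => mu a *: s a) &
    forall a, \det (mu a *: s a) = 1].
Proof.
move=> w; have [mu hmu] : exists mu : A -> F, forall a, mu a != 0 /\ \det (mu a *: s a) = 1.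
  apply: (@fin_all_exists A (fun=> F) (fun a c => c != 0 /\ \det (c *: s a) = 1)) => a.
  by have [c c0 hc] := scale_det1 n_gt0 (weyl_unit w a); exists c.
exists mu; split=> [a||a]; [by case: (hmu a)| |by case: (hmu a)].
by apply: (weyl_scale charF0 n_gt0) => // a; case: (hmu a).
Qed.

Lemma det1_unit (g : 'M[F]_n) : \det g = 1 -> g \in unitmx.
Proof. by move=> h; rewrite unitmxE h unitr1. Qed.

Lemma scale_eq_neq0 (g h : 'M[F]_n) c : g \in unitmx -> g = c *: h -> c != 0.
Proof.
move=> gU e; apply/eqP => c0; have := unitmx_neq0 charF0 n_gt0 gU.
by rewrite e c0 scale0r eqxx.
Qed.

Lemma proj_eq_sym (g h : 'M[F]_n) : h \in unitmx -> proj_eq g h -> proj_eq h g.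
Proof.
move=> hU [c e]; have c0 := scale_eq_neq0 hU e.
by exists c^-1; rewrite e scalerA mulVf ?scale1r.
Qed.

Lemma proj_eq_trans (g h k : 'M[F]_n) : proj_eq g h -> proj_eq h k -> proj_eq g k.
Proof. by move=> [c ->] [d ->]; exists (d * c); rewrite scalerA. Qed.

Lemma proj_eq_mul (g g' h h' : 'M[F]_n) :
  proj_eq g g' -> proj_eq h h' -> proj_eq (g *m h) (g' *m h').
Proof. by move=> [c ->] [d ->]; exists (c * d); rewrite -scalemxAl -scalemxAr scalerA. Qed.

Lemma proj_eq_refl (g : 'M[F]_n) : proj_eq g g.
Proof. by exists 1; rewrite scale1r. Qed.

Lemma weyl_proj_inj (A : finZmodType) (phi : A -> A -> QZ) (s : A -> 'M[F]_n) a b :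
  weyl xi phi s -> proj_eq (s a) (s b) -> a = b.
Proof.
move=> w [c e]; apply/eqP; apply: contraT; rewrite eq_sym => ab.
have c0 := scale_eq_neq0 (weyl_unit w b) e.
have := weyl_tr_orth charF0 n_gt0 w ab; rewrite e -scalemxAl mulmxV ?(weyl_unit w) //.
rewrite mxtraceZ mxtrace1 => /eqP.
by rewrite mulf_eq0 (negPf c0) (negPf (natF_neq0 charF0 n_gt0)).
Qed.

(** Both products have the same nonzero determinant, whence [c ^+ n = 1]. *)
Lemma commutator_root (g h : 'M[F]_n) c : g \in unitmx -> h \in unitmx ->
  g *m h = c *: (h *m g) -> exists k : nat, c = xi ^+ k.
Proof.
move=> gU hU /(congr1 determinant); rewrite detZ !det_mulmx => e.
have d0 : \det h * \det g != 0 by rewrite mulf_neq0 // -unitfE -unitmxE.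
have c1 : c ^+ n = 1 by apply: (mulIf d0); rewrite mul1r -e mulrC.
by have [k ->] := prim_rootP xi_prim c1; exists k.
Qed.

Lemma qz_of_prim_root a b : xi ^+ a = xi ^+ b -> qz_of (a%:R / n%:R) = qz_of (b%:R / n%:R).
Proof.
move/eqP; rewrite (eq_prim_root_expr xi_prim) => /eqP e.
by rewrite -(qz_of_frac_mod a n_gt0) e qz_of_frac_mod.
Qed.

Section Centralizer.
Variable H : 'M[F]_n -> Prop.

Lemma in_U_unit g : in_U H g -> g \in unitmx.
Proof. by case=> /det1_unit. Qed.

Lemma in_U_mul g g' : in_U H g -> in_U H g' -> in_U H (g *m g').
Proof.
move=> [d1 h1] [d2 h2]; split; first by rewrite det_mulmx d1 d2 mulr1.
move=> h hH; have [c hc] := h1 h hH; have [d hd] := h2 h hH; exists (d * c).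
by rewrite -mulmxA hd -scalemxAr (mulmxA g) hc -scalemxAl scalerA mulmxA.
Qed.

Lemma in_U_commute_proj g h : (forall h, H h -> \det h = 1) -> in_U H g -> H h ->
  exists2 c : F, c != 0 & g *m h = c *: (h *m g).
Proof.
move=> Hdet [dg hg] hH; have [c hc] := hg h hH; exists c => //.
by apply: scale_eq_neq0 hc; rewrite unitmx_mul (det1_unit dg) (det1_unit (Hdet h hH)).
Qed.

Lemma in_U_inv g : (forall h, H h -> \det h = 1) -> in_U H g -> in_U H (invmx g).
Proof.
move=> Hdet hg; have gU := in_U_unit hg; split.
  by rewrite det_inv; case: hg => -> _; rewrite invr1.
move=> h hH; have [c c0 hc] := in_U_commute_proj Hdet hg hH; exists c^-1.
have := congr1 (fun X => c^-1 *: (invmx g *m X *m invmx g)) hc.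
rewrite !mulmxA mulVmx // mul1mx -scalemxAr -scalemxAl !mulmxA mulmxK // scalerA mulVf // scale1r.
by move=> ->.
Qed.

Lemma in_U1 : in_U H 1%:M.
Proof. by split=> [|h _]; [rewrite det1|exists 1; rewrite mul1mx mulmx1 scale1r]. Qed.

Hypothesis irrH : irreducible_SL_subgroup H.

Let Hdet h : H h -> \det h = 1. Proof. by case: irrH => -[_ _ _ h4] _; apply: h4. Qed.

Lemma irr_schur g : (forall h, H h -> g *m h = h *m g) -> exists c, g = c%:M.
Proof.
move=> gc; have [a ha] := closed_eigenvalue g n_gt0; exists a.
have [|U0|Uf] := irrH.2 (eigenspace g a).
- by move=> h hH; apply: comm_mx_stable_eigenspace; exact: gc.
- by move: ha; rewrite /eigenvalue U0 eqxx.
have /eigenspaceP : (1%:M <= eigenspace g a)%MS by rewrite submx_full.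
by rewrite mul1mx scalemx1.
Qed.

Lemma in_U_tr g : in_U H g -> (exists c, g = c%:M) \/ \tr g = 0.
Proof.
move=> gU; have [|hN] := classic (forall h, H h -> g *m h = h *m g); first by left; apply: irr_schur.
right; have [h hh] := not_all_ex_not _ _ hN; have [hH ghN] := imply_to_and _ _ hh.
have [c c0 e] := in_U_commute_proj Hdet gU hH; have hU := det1_unit (Hdet hH).
have c1 : c != 1 by apply: contra_not_neq ghN => c1; rewrite e c1 scale1r.
have : \tr g = c * \tr g.
  by rewrite -mxtraceZ -[g in LHS](mulmxK hU) e -scalemxAl !mxtraceZ mxtrace_mulC mulmxA mulVmx // mul1mx.
move/eqP; rewrite -{1}[\tr g]mul1r -subr_eq0 -mulrBl mulf_eq0 subr_eq0 eq_sym (negPf c1).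
by move/eqP.
Qed.

Lemma in_U_orth g g' : in_U H g -> in_U H g' -> ~ proj_eq g' g -> \tr (g *m invmx g') = 0.
Proof.
move=> gU g'U np; have [[c hc]|//] := in_U_tr (in_U_mul gU (in_U_inv Hdet g'U)).
by case: np; exists c; rewrite -[g](mulmxKV (in_U_unit g'U)) hc mul_scalar_mx.
Qed.

(** Distinct classes modulo scalars are trace-orthogonal. The bound gives both the finiteness of the
    centralizers and the maximality of those of order n^2. *)
Lemma in_U_bound (I : finType) (f : I -> 'M[F]_n) : (forall i, in_U H (f i)) ->
  (forall i j, proj_eq (f i) (f j) -> i = j) -> (#|I| <= n ^ 2)%N.
Proof.
move=> fU finj; apply: (orth_family_free (natF_neq0 charF0 n_gt0) (f := f) _ _).1.
  by move=> i; apply: in_U_unit.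
move=> i j ij; apply: in_U_orth => // /finj ji.
by rewrite ji eqxx in ij.
Qed.

(** The two products pick up the same scalar when moved past any [h] in [H], so their quotient
    commutes with [H] and is scalar by Schur's lemma. Hence the centralizer in PSL is abelian. *)
Lemma in_U_commute g g' : in_U H g -> in_U H g' -> exists c, g *m g' = c *: (g' *m g).
Proof.
move=> hg hg'; have gU := in_U_unit hg; have g'U := in_U_unit hg'.
have YU : g' *m g \in unitmx by rewrite unitmx_mul g'U.
have [|c hc] := @irr_schur (g *m g' *m invmx (g' *m g)); last first.
  by exists c; rewrite -mul_scalar_mx -hc mulmxKV.
move=> h hH; have [c c0 e] := in_U_commute_proj Hdet hg hH.
have [d d0 e'] := in_U_commute_proj Hdet hg' hH.
have X : g *m g' *m h = (c * d) *: (h *m (g *m g')).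
  by rewrite -mulmxA e' -scalemxAr (mulmxA g) e -scalemxAl scalerA !mulmxA mulrC.
have Y : g' *m g *m h = (c * d) *: (h *m (g' *m g)).
  by rewrite -mulmxA e -scalemxAr (mulmxA g') e' -scalemxAl scalerA !mulmxA.
have cd0 : c * d != 0 by rewrite mulf_neq0.
have Y' : invmx (g' *m g) *m h = (c * d)^-1 *: (h *m invmx (g' *m g)).
  have := congr1 (fun Z => (c * d)^-1 *: (invmx (g' *m g) *m Z *m invmx (g' *m g))) Y.
  rewrite -!scalemxAr -!scalemxAl scalerA mulVf // scale1r.
  move: (g' *m g) YU => y yU.
  by rewrite !mulmxA mulVmx // mul1mx mulmxK // => <-.
by rewrite -(mulmxA _ (invmx _) h) Y' -scalemxAr (mulmxA (g *m g')) X -scalemxAl scalerA mulVf // scale1r !mulmxA.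
Qed.

(** Otherwise every finite family of pairwise inequivalent elements could be enlarged, eventually
    beyond n^2. *)
Lemma in_U_system : exists (k : nat) (f : 'I_k -> 'M[F]_n), [/\ forall i, in_U H (f i),
  forall i j, proj_eq (f i) (f j) -> i = j & forall g, in_U H g -> exists i, proj_eq (f i) g].
Proof.
apply: NNPP => hN.
suff S k : exists f : 'I_k -> 'M[F]_n, (forall i, in_U H (f i)) /\
    (forall i j, proj_eq (f i) (f j) -> i = j).
  have [f [h1 h2]] := S (n ^ 2).+1; have := in_U_bound h1 h2.
  by rewrite card_ord ltnn.
elim: k => [|k [f [fU finj]]]; first by exists (fun=> 1%:M); split=> -[].
have [g [gU hg]] : exists g, in_U H g /\ forall i, ~ proj_eq (f i) g.
  apply: NNPP => hN'; apply: hN; exists k, f; split=> // g gU.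
  apply: NNPP => hN''; apply: hN'; exists g; split=> // i hi.
  by apply: hN''; exists i.
exists (fun i => if unlift ord_max i is Some j then f j else g); split.
  by move=> i; case: unliftP => [j|] _ //.
move=> i j; case: unliftP => [i'|] ->; case: unliftP => [j'|] -> //.
- by move/finj => ->.
- by move/hg.
- by move/(proj_eq_sym (in_U_unit (fU _)))/hg.
Qed.

(** The group law is transported to the indices of a system of representatives; its axioms hold
    because a class determines its index. The form is read off from the exponents of [xi] in the
    commutators. *)
Lemma in_U_isometric : exists (A : finZmodType) (phi : A -> A -> QZ),
  alternate phi /\ centralizer_isometric xi H phi.
Proof.
have [k [f [fU finj fsurj]]] := in_U_system.
have unit i := in_U_unit (fU i).
have uniq i j g : g \in unitmx -> proj_eq (f i) g -> proj_eq (f j) g -> i = j.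
  by move=> gU hi hj; apply: finj; apply: proj_eq_trans hi _; exact: proj_eq_sym hj.
have [add addP] : exists add : 'I_k * 'I_k -> 'I_k,
    forall p, proj_eq (f (add p)) (f p.1 *m f p.2).
  apply: (@fin_all_exists _ (fun=> 'I_k) (fun p l => proj_eq (f l) (f p.1 *m f p.2))) => p.
  by apply: fsurj; apply: in_U_mul.
have [opp oppP] : exists opp : 'I_k -> 'I_k, forall i, proj_eq (f (opp i)) (invmx (f i)).
  apply: (@fin_all_exists _ (fun=> 'I_k) (fun i l => proj_eq (f l) (invmx (f i)))) => i.
  by apply: fsurj; apply: in_U_inv.
have [zero zeroP] := fsurj _ in_U1.
have addA : associative (fun i j => add (i, j)).
  move=> i j l; apply: (uniq _ _ (f i *m (f j *m f l))); first by rewrite !unitmx_mul !unit.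
    apply: proj_eq_trans (addP _) _; apply: proj_eq_mul; first exact: proj_eq_refl.
    exact: (addP (_, _)).
  rewrite mulmxA; apply: proj_eq_trans (addP _) _; apply: proj_eq_mul; last exact: proj_eq_refl.
  exact: (addP (_, _)).
have addC : commutative (fun i j => add (i, j)).
  move=> i j; apply: (uniq _ _ (f i *m f j)); first by rewrite !unitmx_mul !unit.
    exact: (addP (_, _)).
  exact: proj_eq_trans (addP (_, _)) (in_U_commute (fU i) (fU j)).
have add0 : left_id zero (fun i j => add (i, j)).
  move=> i; apply: (uniq _ _ (1%:M *m f i)); first by rewrite mul1mx unit.
    exact: proj_eq_trans (addP (zero, i)) (proj_eq_mul zeroP (proj_eq_refl _)).
  by rewrite mul1mx; exact: proj_eq_refl.
have addN : left_inverse zero opp (fun i j => add (i, j)).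
  move=> i; apply: (uniq _ _ 1%:M) => //; first by rewrite unitmx1.
  rewrite -(mulVmx (unit i)).
  exact: proj_eq_trans (addP (opp i, i)) (proj_eq_mul (oppP i) (proj_eq_refl _)).
pose A : finZmodType := HB.pack 'I_k (GRing.isZmodule.Build 'I_k addA addC add0 addN).
have [kap kapP] : exists kap : 'I_k * 'I_k -> nat,
    forall p, f p.1 *m f p.2 = xi ^+ kap p *: (f p.2 *m f p.1).
  apply: (@fin_all_exists _ (fun=> nat)
    (fun p l => f p.1 *m f p.2 = xi ^+ l *: (f p.2 *m f p.1))) => p.
  have [c hc] := in_U_commute (fU p.1) (fU p.2).
  by have [l hl] := commutator_root (unit _) (unit _) hc; exists l; rewrite -hl.
pose phi (a b : A) := qz_of ((kap (a, b))%:R / n%:R).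
have phiE (a b : A) l : f a *m f b = xi ^+ l *: (f b *m f a) -> phi a b = qz_of (l%:R / n%:R).
  move=> e; apply: qz_of_prim_root; have := kapP (a, b); rewrite e /= => e'.
  by apply: (unitmx_scale_inj charF0 n_gt0 (M := f b *m f a)); rewrite ?unitmx_mul ?unit.
have phiD (a b c : A) : phi (a + b) c = phi a c + phi b c.
  rewrite /phi -qz_of_fracD; apply: phiE.
  have [d hd] := addP (a, b); rewrite /= in hd.
  have ab0 : f a *m f b \in unitmx by rewrite unitmx_mul !unit.
  have d0 := scale_eq_neq0 ab0 hd.
  have e : f (a + b) = d^-1 *: (f a *m f b).
    by rewrite hd scalerA mulVf // scale1r.
  rewrite e -!scalemxAl -!scalemxAr scalerA mulrC -scalerA; congr (_ *: _).
  have /= e1 := kapP (a, c); have /= e2 := kapP (b, c).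
  by rewrite -mulmxA e2 -scalemxAr (mulmxA (f a)) e1 -scalemxAl scalerA mulmxA exprD mulrC.
have phiC (a b : A) : phi a b = - phi b a.
  apply/eqP; rewrite -addr_eq0 -qz_of_fracD; apply/eqP; rewrite -qz_of0.
  have -> : (0 : rat) = 0%:R / n%:R by rewrite mul0r.
  apply: qz_of_prim_root; have /= e1 := kapP (a, b); have /= e2 := kapP (b, a).
  apply: (unitmx_scale_inj charF0 n_gt0 (M := f a *m f b)); first by rewrite unitmx_mul !unit.
  by rewrite expr0 scale1r exprD -scalerA -e2 -e1.
exists A, phi; split.
  split=> [//|a b c|a]; first by rewrite phiC phiD opprD -!phiC.
  by rewrite (phiE a a 0%N) ?mul0r // expr0 scale1r.
exists f; split=> //.
by move=> a b; apply: proj_eq_sym (addP (a, b)); rewrite unitmx_mul !unit.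
Qed.

Lemma isometric_weyl (A : finZmodType) (phi : A -> A -> QZ) (s : A -> 'M[F]_n) :
    (forall a, in_U H (s a)) -> (forall a b, proj_eq (s a) (s b) -> a = b) ->
    (forall a b, proj_eq (s a *m s b) (s (a + b))) ->
    (forall a b (k : nat), s a *m s b = xi ^+ k *: (s b *m s a) -> phi a b = qz_of (k%:R / n%:R)) ->
  weyl xi phi s.
Proof.
move=> sU sinj sM sphi; have unit a := in_U_unit (sU a).
split=> // [a b|a b|a a0].
- have [c e] := proj_eq_sym (unit _) (sM a b); by exists c.
- have [c hc] := in_U_commute (sU a) (sU b).
  have [k hk] := commutator_root (unit _) (unit _) hc.
  by rewrite (sphi a b k) -?hk // (qexpE xi_prim) -hk.
(* A scalar [s a] would give [a + a = a]. *)
have [[c hc]|//] := in_U_tr (sU a); case/eqP: a0.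
apply: (addrI a); rewrite addr0; apply: sinj; apply: (proj_eq_sym (unit _)).
apply: proj_eq_trans _ (sM a a).
by exists c; rewrite {1}hc mul_scalar_mx.
Qed.

Lemma isometric_tors (A : finZmodType) (phi : A -> A -> QZ) :
  centralizer_isometric xi H phi -> forall a b, phi a b *+ n = 0.
Proof.
move=> [s [sU _ _ _ sphi]] a b; have [c hc] := in_U_commute (sU a) (sU b).
have [k hk] := commutator_root (in_U_unit (sU a)) (in_U_unit (sU b)) hc.
rewrite (sphi a b k) -?hk // -qz_of_mulrn -(mulr_natr (_ / _)) divfK ?qz_of_nat //.
by rewrite pnatr_eq0 -lt0n.
Qed.

End Centralizer.
End Projective.

(** * Realization on functions on B *)

Section Schrodinger.
Variables (F : closedFieldType) (n : nat) (xi : F).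
Hypotheses (charF0 : [pchar F] =i pred0) (n_gt0 : (0 < n)%N) (xi_prim : n.-primitive_root xi).
Variables (B : finZmodType) (cB : #|B| = n).

Let bt (i : 'I_n) : B := enum_val (cast_ord (esym cB) i).
Let bt' (x : B) : 'I_n := cast_ord cB (enum_rank x).
Let btK : cancel bt bt'. Proof. by move=> i; rewrite /bt' /bt enum_valK cast_ordKV. Qed.
Let bt'K : cancel bt' bt. Proof. by move=> i; rewrite /bt' /bt cast_ordK enum_rankK. Qed.
Let bt_bij : bijective bt. Proof. by exists bt'. Qed.

(** On column vectors, seen as functions u on [B], this sends u to the function whose value at x is
    u(x + b) times the character value of f(x). *)
Definition schrodinger (b : B) (f : B -> QZ) : 'M[F]_n :=
  \matrix_(i, j) (qexp xi n (f (bt i)) * (bt j == bt i + b)%:R).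

Let tors (f : B -> QZ) : {morph f : x y / x + y} -> forall x, f x *+ n = 0.
Proof. by move=> fD x; rewrite -cB qz_mulrn_card. Qed.

Lemma schrodinger_mul b f b' f' : {morph f : x y / x + y} -> {morph f' : x y / x + y} ->
  schrodinger b f *m schrodinger b' f' =
  qexp xi n (f' b) *: schrodinger (b + b') (fun x => f x + f' x).
Proof.
move=> fD f'D; apply/matrixP => i k; rewrite !mxE.
rewrite (bigD1 (bt' (bt i + b))) //= big1 => [|j hj]; last first.
  rewrite !mxE (_ : bt j == bt i + b = false) ?mulr0 ?mul0r //.
  by apply: contraNF hj => /eqP <-; rewrite btK.
rewrite addr0 !mxE !bt'K eqxx mulr1 f'D addrA.
rewrite (qexpD xi_prim (tors f'D _) (tors f'D _)) (qexpD xi_prim (tors fD _) (tors f'D _)).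
ring.
Qed.

(** A nonzero translation has zero diagonal, and the trace of a pure modulation is a nontrivial
    character sum. *)
Lemma schrodinger_tr b f : {morph f : x y / x + y} -> b != 0 \/ (exists x, f x != 0) ->
  \tr (schrodinger b f) = 0.
Proof.
move=> fD; rewrite /mxtrace; have [->|b0 _] := eqVneq b 0; last first.
  apply: big1 => i _; rewrite mxE -[X in X == _]addr0 (inj_eq (addrI _)) eq_sym (negPf b0).
  by rewrite mulr0.
case=> // -[x fx].
rewrite (eq_bigr (fun i => qexp xi n (f (bt i)))) => [|i _]; last first.
  by rewrite mxE addr0 eqxx mulr1.
rewrite -(reindex bt (P := predT) (F := fun x => qexp xi n (f x))) /=; last exact: onW_bij.
transitivity (\sum_(y in [set: B]) qexp xi n (f y)).
  by apply: eq_bigl => y; rewrite in_setT.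
apply: (@char_sum F B setT (fun x => qexp xi n (f x)) x (zmod_closedT B)).
- by move=> u v _ _; rewrite fD (qexpD xi_prim) ?tors.
- by rewrite in_setT.
- by rewrite (qexp_eq1 xi_prim) ?tors.
Qed.

Lemma schrodinger_scalar : schrodinger 0 (fun=> 0) = 1%:M.
Proof.
apply/matrixP => i j; rewrite !mxE (qexp0 xi_prim) mul1r addr0.
by rewrite (inj_eq (can_inj btK)) eq_sym.
Qed.

Lemma BBstar_weyl (A : finZmodType) (phi : A -> A -> QZ) :
    isometric_embedding_BBstar phi B ->
  exists s : A -> 'M[F]_n, weyl xi phi s.
Proof.
move=> [eb [ef [efDr ebD efDl inj iso]]].
have eb0 : eb 0 = 0 by apply: (addIr (eb 0)); rewrite -ebD !add0r.
have ef0 x : ef 0 x = 0 by apply: (addIr (ef 0 x)); rewrite -efDl !add0r.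
pose s a := schrodinger (eb a) (ef a).
have sM a a' : s a *m s a' = qexp xi n (ef a' (eb a)) *: s (a + a').
  rewrite /s schrodinger_mul //; congr (_ *: _); apply/matrixP => i j.
  by rewrite !mxE ebD efDl.
have T a x := tors (efDr a) x.
have q0 a a' : qexp xi n (ef a' (eb a)) != 0.
  apply/eqP => q0; have := qexp_exp xi_prim (T a' (eb a)); rewrite q0 expr0n eqn0Ngt n_gt0.
  by move/eqP; rewrite eq_sym oner_eq0.
exists s; split=> [a|a b|a b|a a0].
- have [] // : s a \in unitmx /\ s (- a) \in unitmx.
  have e : s a *m ((qexp xi n (ef (- a) (eb a)))^-1 *: s (- a)) = 1%:M.
    rewrite -scalemxAr sM scalerA mulVf // scale1r subrr -schrodinger_scalar.
    by apply/matrixP => i j; rewrite !mxE eb0 ef0.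
  have [h1 h2] := mulmx1_unit e; split=> //.
  by move: h2; rewrite unitmxZ ?unitfE ?invr_eq0.
- by eexists; apply: sM.
- rewrite !sM scalerA [b + a]addrC; congr (_ *: _).
  have -> : ef b (eb a) = phi a b + ef a (eb b) by rewrite iso subrK.
  by rewrite (qexpD xi_prim) // iso mulrnBl !T subr0.
apply: schrodinger_tr => //.
have [eba|] := eqVneq (eb a) 0; last by left.
right; apply: NNPP => hN; case/eqP: a0; apply: inj; first by rewrite eba eb0.
move=> x; rewrite ef0; apply/eqP; apply: contraT => fx.
by case: hN; exists x.
Qed.

Lemma BBstar_tors (A : finZmodType) (phi : A -> A -> QZ) :
  isometric_embedding_BBstar phi B -> forall a b, phi a b *+ n = 0.
Proof.
move=> [eb [ef [efDr _ _ _ iso]]] a b.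
by rewrite iso mulrnBl !(tors (efDr _)) subr0.
Qed.

End Schrodinger.

(** * The matrix group of a module of order n^2 *)

Section WeylGroup.
Variables (F : closedFieldType) (n : nat) (xi : F).
Hypotheses (charF0 : [pchar F] =i pred0) (n_gt0 : (0 < n)%N) (xi_prim : n.-primitive_root xi).
Variables (W : finZmodType) (om : W -> W -> QZ) (r : W -> 'M[F]_n).
Hypotheses (rW : weyl xi om r) (rdet : forall w, \det (r w) = 1) (cW : #|W| = (n ^ 2)%N).

Definition weyl_group (g : 'M[F]_n) : Prop := \det g = 1 /\ exists w c, g = c *: r w.

Lemma weyl_group_gen w : weyl_group (r w).
Proof. by split=> //; exists w, 1; rewrite scale1r. Qed.

Lemma weyl_group_irr : irreducible_SL_subgroup weyl_group.
Proof.
split; last first.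
  by move=> U h; apply: (weyl_stable_full charF0 n_gt0 rW) => // w; apply/h/weyl_group_gen.
split=> [||g [dg [w [c e]]]|g []//].
- split; first by rewrite det1.
  have [c c0 h] := weyl0 charF0 n_gt0 rW; exists 0, c^-1.
  by rewrite h scale_scalar_mx mulVf.
- move=> g h [dg [w [c e]]] [dh [w' [c' e']]]; split; first by rewrite det_mulmx dg dh mulr1.
  have [d _ hd] := weyl_mul charF0 n_gt0 rW w w'; exists (w + w'), (c * c' * d).
  by rewrite e e' -scalemxAl -scalemxAr hd !scalerA.
split; first by rewrite det_inv dg invr1.
have [d _ hd] := weyl_inv charF0 n_gt0 rW w; exists (- w), (c^-1 * d).
by rewrite e invmxZ -?e ?det1_unit // hd scalerA.
Qed.

Lemma weyl_commute_group g : (forall w, exists c, g *m r w = c *: (r w *m g)) ->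
  forall h, weyl_group h -> exists c, g *m h = c *: (h *m g).
Proof.
move=> hg _ [_ [w [c ->]]]; have [d hd] := hg w; exists d.
by rewrite -scalemxAr hd -scalemxAl !scalerA mulrC.
Qed.

Lemma weyl_in_U w : in_U weyl_group (r w).
Proof.
split=> //; apply: weyl_commute_group => w'.
by exists (qexp xi n (om w w')); exact: weyl_comm.
Qed.

(** The matrices [r w] already provide n^2 classes, the most that [in_U_bound] allows. *)
Lemma weyl_in_U_proj g : in_U weyl_group g -> exists w, proj_eq (r w) g.
Proof.
move=> gU; apply: NNPP => hN.
pose f (o : option W) := if o is Some w then r w else g.
have : (#|{: option W}| <= n ^ 2)%N.
  apply: (in_U_bound charF0 n_gt0 weyl_group_irr (f := f)).
    by case=> [w|] //; apply: weyl_in_U.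
  move=> [w|] [w'|] //= h.
  - by rewrite (weyl_proj_inj charF0 n_gt0 rW h).
  - by case: hN; exists w.
  - by case: hN; exists w'; apply: (proj_eq_sym charF0 n_gt0 _ h); exact: weyl_unit rW w'.
by rewrite card_option cW ltnn.
Qed.

Lemma weyl_centralizer_card : centralizer_card weyl_group (n ^ 2).
Proof.
exists (fun i => r (enum_val (cast_ord (esym cW) i))); split=> [i|g /weyl_in_U_proj [w hw]|i j].
- exact: weyl_in_U.
- by exists (cast_ord cW (enum_rank w)); rewrite cast_ordK enum_rankK.
- by move/(weyl_proj_inj charF0 n_gt0 rW)/enum_val_inj/cast_ord_inj.
Qed.

End WeylGroup.

(** * The equivalences and the maximal centralizers *)

Section Main.
Variables (F : closedFieldType) (n : nat) (xi : F).
Hypotheses (charF0 : [pchar F] =i pred0) (n_gt0 : (0 < n)%N) (xi_prim : n.-primitive_root xi).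

Lemma in_U_anti (H H' : 'M[F]_n -> Prop) : (forall g, H' g -> H g) ->
  forall g, in_U H g -> in_U H' g.
Proof. by move=> sub g [dg hg]; split=> // h /sub; apply: hg. Qed.

Lemma isometric_lagr (A : finZmodType) (phi : A -> A -> QZ) (H : 'M[F]_n -> Prop) :
  alternate phi -> irreducible_SL_subgroup H -> centralizer_isometric xi H phi ->
  lagr_order_dvd phi n.
Proof.
move=> phi_alt irrH [s [h1 h2 h3 h4 h5]].
apply: (weyl_lagr_order charF0 n_gt0 xi_prim (s := s)) => //.
exact: isometric_weyl h1 h3 h4 h5.
Qed.

Lemma weyl_cover (A : finZmodType) (phi : A -> A -> QZ) : alternate phi -> lagr_order_dvd phi n ->
  exists (W : finZmodType) (om : W -> W -> QZ) (i : A -> W) (r : W -> 'M[F]_n),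
    [/\ alternate om, (forall w, (forall w', om w w' = 0) -> w = 0), #|W| = (n ^ 2)%N &
        forall w w', om w w' *+ n = 0] /\
    [/\ {morph i : x y / x + y}, injective i, (forall x y, om (i x) (i y) = phi x y),
        weyl xi om r & forall w, \det (r w) = 1].
Proof.
move=> phi_alt hn.
have [W [B [om [i [[h1 h2 h3] [h4 h5 h6 cB emb]]]]]] := lagr_symplectic_cover n_gt0 phi_alt hn.
have [s sw] := BBstar_weyl n_gt0 xi_prim cB emb.
have [mu [_ h7 h8]] := weyl_normalize charF0 n_gt0 sw.
exists W, om, i, (fun a => mu a *: s a); split; split=> //.
exact: BBstar_tors emb.
Qed.

(** [t] avoids 0 and the eigenvalues of [M]. This turns a matrix of the span into an invertible one,
    which can then be scaled to determinant 1. *)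
Lemma sub_scalar_unit (M : 'M[F]_n) : exists2 t, t != 0 & M - t%:M \in unitmx.
Proof.
have /closed_nonrootP [t] : char_poly M * 'X != 0.
  by rewrite mulf_neq0 ?polyX_eq0 // monic_neq0 // char_poly_monic.
rewrite rootM negb_or rootX => /andP [ht t0]; exists t => //.
move: ht; rewrite -eigenvalue_root_char /eigenvalue negbK /eigenspace kermx_eq0.
by rewrite row_free_unit.
Qed.

(** [H] consists of the matrices of determinant 1 commuting projectively with the image of [A]. It
    contains [weyl_group r], which makes it irreducible and confines its centralizer to [W]. *)
Lemma lagr_isometric (A : finZmodType) (phi : A -> A -> QZ) :
    alternate phi -> lagr_order_dvd phi n ->
  exists H : 'M[F]_n -> Prop, irreducible_SL_subgroup H /\ centralizer_isometric xi H phi.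
Proof.
move=> phi_alt hn.
have [W [om [i [r [[om_alt nd cW tors] [iD iinj iso rW rdet]]]]]] := weyl_cover phi_alt hn.
have rU := weyl_unit rW.
pose H (g : 'M[F]_n) := \det g = 1 /\ forall a, exists c, g *m r (i a) = c *: (r (i a) *m g).
have Hgroup : SL_subgroup H.
  have UE g : H g <-> in_U (fun h => exists a, h = r (i a)) g.
    split=> -[dg hg]; split=> //; first by move=> _ [a ->].
    by move=> a; apply: hg; exists a.
  split=> [|g h /UE hg /UE hh|g /UE hg|g []//]; apply/UE.
  - exact: in_U1.
  - exact: in_U_mul.
  - by apply: in_U_inv => // _ [a ->].
have subH g : weyl_group r g -> H g.
  move=> [dg [w [c e]]]; split=> // a; exists (qexp xi n (om w (i a))).
  by rewrite e -scalemxAl (weyl_comm rW) -scalemxAr !scalerA mulrC.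
exists H; split.
  split=> // U hU; apply: (weyl_stable_full charF0 n_gt0 rW) => // w.
  by apply/hU/subH/weyl_group_gen.
exists (fun a => r (i a)); split.
- move=> a; split=> // h [dh hh]; have [c hc] := hh a.
  have c0 : c != 0.
    by apply: (scale_eq_neq0 charF0 n_gt0 _ hc); rewrite unitmx_mul rU det1_unit.
  by exists c^-1; rewrite hc scalerA mulVf ?scale1r.
- move=> g gU.
  have [w [c hc]] := weyl_in_U_proj charF0 n_gt0 rW rdet cW (in_U_anti subH gU).
  have c0 : c != 0 by apply: (scale_eq_neq0 charF0 n_gt0 _ hc); exact: in_U_unit gU.
  (* It suffices that some [i a] pairs with [W] as [w] does; [pairing_dual] reduces this to
     [om w u = 0] for every [u] orthogonal to [A]. *)
  have [a _ ha] : exists2 a, a \in [set: A] &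
      forall w', w' \in [set: W] -> om (i a) w' = om w w'.
    apply: (@pairing_dual A W (fun a => om (i a)) _ _ setT setT (zmod_closedT A) (zmod_closedT W)).
    + by move=> x x' y; rewrite iD (altDl om_alt).
    + by move=> x y y'; rewrite (altDr om_alt).
    + by move=> y y'; rewrite (altDr om_alt).
    move=> u _ hu; have [->|u0] := eqVneq u 0; first exact: altx0.
    (* [r u - t] commutes with [A] because [u] is orthogonal to [A]; since [1] and [r u] are
       independent, it commutes projectively with [r w] only if [om w u = 0]. *)
    have [t t0 MU] := sub_scalar_unit (r u).
    have [d d0 dM] := scale_det1 n_gt0 MU.
    have MH : H (d *: (r u - t%:M)).
      split=> // a; exists 1; rewrite scale1r -scalemxAl -scalemxAr; congr (_ *: _).
      rewrite mulmxBl mulmxBr scalar_mxC (weyl_comm rW) (altC om_alt) hu ?in_setT //.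
      by rewrite oppr0 (qexp0 xi_prim) scale1r.
    case: gU => _ /(_ _ MH) [e]; rewrite hc -!scalemxAr -!scalemxAl !scalerA.
    move/(congr1 (fun X => (d * c)^-1 *: X)).
    rewrite !scalerA mulVf ?mulf_neq0 // (_ : (d * c)^-1 * (e * (c * d)) = e); last first.
      by field; rewrite c0 d0.
    rewrite scale1r mulmxBr mulmxBl (weyl_comm rW) scalar_mxC.
    set q := qexp _ _ _ => /(congr1 (fun X => X *m invmx (r w))).
    rewrite mulmxBl -!scalemxAl !mulmxBl !mulmxK // => E.
    (* Since [r u] has trace 0 and [t] is nonzero, comparing traces gives [e = 1]; what remains of
       [E] then gives [q = 1]. *)
    have := congr1 (fun X => \tr X) E.
    rewrite /= mxtraceZ !raddfB /= mxtraceZ (weyl_tr rW u0) mulr0 !sub0r mxtrace_scalar.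
    have tn0 : t *+ n != 0 by rewrite -mulr_natr mulf_neq0 // natF_neq0.
    move/eqP; rewrite mulrN eqr_opp -{1}[t *+ n]mul1r (inj_eq (mulIf tn0)) => /eqP e1.
    move: E; rewrite -e1 scale1r => /addIr; rewrite -[X in _ = X]scale1r.
    move/(unitmx_scale_inj charF0 n_gt0 (rU u))/eqP.
    by rewrite (qexp_eq1 xi_prim) // => /eqP.
  exists a; exists c; rewrite hc; congr (_ *: r _); apply/eqP; rewrite eq_sym -subr_eq0.
  apply/eqP/nd => w'; by rewrite (altDl om_alt) (altNl om_alt) ha ?in_setT // subrr.
- by move=> a b /(weyl_proj_inj charF0 n_gt0 rW)/iinj.
- move=> a b; apply: (proj_eq_sym charF0 n_gt0); first by rewrite unitmx_mul !rU.
  by have [c _ hc] := weyl_mul charF0 n_gt0 rW (i a) (i b); exists c; rewrite iD.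
- move=> a b k e; have := weyl_comm rW (i a) (i b); rewrite iso e.
  have /(qz_torsionP n_gt0) [l ->] : phi a b *+ n = 0 by rewrite -iso.
  rewrite (qexpE xi_prim) => /(unitmx_scale_inj charF0 n_gt0) h.
  by apply: (qz_of_prim_root n_gt0 xi_prim); rewrite h // unitmx_mul !rU.
Qed.

Lemma irr_maximal_cover (H : 'M[F]_n -> Prop) : irreducible_SL_subgroup H ->
  exists H' : 'M[F]_n -> Prop, [/\ irreducible_SL_subgroup H',
    (forall g, in_U H g -> in_U H' g) & centralizer_card H' (n ^ 2)].
Proof.
move=> irrH.
have [A [phi [phi_alt hiso]]] := in_U_isometric charF0 n_gt0 xi_prim irrH.
have hn := isometric_lagr phi_alt irrH hiso.
have torsA := isometric_tors charF0 n_gt0 xi_prim irrH hiso.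
have [s [sU ssurj sinj sM sphi]] := hiso.
have sW := isometric_weyl charF0 n_gt0 xi_prim irrH sU sinj sM sphi.
have [W [om [i [r [[om_alt nd cW tors] [iD iinj iso rW rdet]]]]]] := weyl_cover phi_alt hn.
have riW : weyl xi phi (fun a => r (i a)).
  split=> [a|a b|a b|a a0].
  - exact: weyl_unit rW _.
  - by have [c _ hc] := weyl_mul charF0 n_gt0 rW (i a) (i b); exists c; rewrite iD.
  - by rewrite -iso; apply: weyl_comm rW _ _.
  - apply: (weyl_tr rW); apply: contra a0 => /eqP h; apply/eqP/iinj; rewrite h.
    by apply: (addIr (i 0)); rewrite -iD !add0r.
have [T TU hT] := intertwiner_exists charF0 n_gt0 xi_prim phi_alt torsA sW riW.
(* [T] intertwines [s] with the restriction of [r] to [A], up to scalars, so the conjugate [r']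
   extends [s] projectively to [W]. *)
pose r' w := T *m r w *m invmx T.
have conjM (X Y : 'M[F]_n) : (T *m X *m invmx T) *m (T *m Y *m invmx T) = T *m (X *m Y) *m invmx T.
  by rewrite !mulmxA mulmxKV.
have conjZ c (X : 'M[F]_n) : T *m (c *: X) *m invmx T = c *: (T *m X *m invmx T).
  by rewrite -scalemxAr -scalemxAl.
have r'W : weyl xi om r'.
  split=> [w|w w'|w w'|w w0].
  - by rewrite !unitmx_mul TU (weyl_unit rW) unitmx_inv.
  - by have [c _ hc] := weyl_mul charF0 n_gt0 rW w w'; exists c; rewrite conjM hc conjZ.
  - by rewrite !conjM (weyl_comm rW) conjZ.
  - by rewrite /r' mxtrace_mulC mulmxA mulVmx // mul1mx (weyl_tr rW).
have r'det w : \det (r' w) = 1.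
  by rewrite !det_mulmx rdet mulr1 -det_mulmx mulmxV // det1.
exists (weyl_group r'); split.
- exact: (weyl_group_irr charF0 n_gt0 r'W r'det cW).
- move=> g gU; split; first by case: gU.
  have [a [c e]] := ssurj g gU; have [d hd] := hT a.
  have sr : s a = d *: r' (i a) by rewrite /r' -conjZ -scalemxAr -hd mulmxK.
  apply: weyl_commute_group => w; exists (qexp xi n (om (i a) w)).
  by rewrite e sr !scalerA -scalemxAl -scalemxAr (weyl_comm r'W) !scalerA mulrC.
- exact: (weyl_centralizer_card charF0 n_gt0 r'W r'det cW).
Qed.

(** An element of the larger centralizer outside the n^2 classes of the smaller one would contradict
    [in_U_bound] for [H']. *)
Lemma card_maximal (H H' : 'M[F]_n -> Prop) : irreducible_SL_subgroup H' ->
  centralizer_card H (n ^ 2) -> (forall g, in_U H g -> in_U H' g) ->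
  forall g, in_U H' g -> in_U H g.
Proof.
move=> irrH' [s [sU ssurj sinj]] sub g gU'.
have [[i [c hc]]|hN] := classic (exists i, proj_eq (s i) g).
  have [_ hs] := sU i; split; first by case: gU'.
  move=> h hH; have [d hd] := hs h hH; exists d.
  by rewrite hc -scalemxAl hd -scalemxAr !scalerA mulrC.
pose f (o : option 'I_(n ^ 2)) := if o is Some i then s i else g.
have : (#|{: option 'I_(n ^ 2)}| <= n ^ 2)%N.
  apply: (in_U_bound charF0 n_gt0 irrH' (f := f)).
    by case=> [i|] //; apply: sub; apply: sU.
  move=> [i|] [j|] //= h.
  - by rewrite (sinj _ _ h).
  - by case: hN; exists i.
  - by case: hN; exists j; apply: (proj_eq_sym charF0 n_gt0 _ h); exact: in_U_unit (sU j).
by rewrite card_option card_ord ltnn.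
Qed.

Lemma centralizer_card_eq (H H' : 'M[F]_n -> Prop) m :
  (forall g, in_U H g <-> in_U H' g) -> centralizer_card H' m -> centralizer_card H m.
Proof.
move=> E [s [h1 h2 h3]]; exists s; split=> // [i|g /E]; [exact/E|exact: h2].
Qed.

End Main.

Unset Implicit Arguments.

Theorem mainTheorem13 (F : closedFieldType) (charF0 : [pchar F] =i pred0)
    (n : nat) (n_gt0 : (0 < n)%N) (xi : F) (xi_prim : n.-primitive_root xi) :
  (forall (A : finZmodType) (phi : A -> A -> QZ), alternate phi ->
     ((exists H : 'M[F]_n -> Prop,
         irreducible_SL_subgroup H /\ centralizer_isometric xi H phi)
      <-> lagr_order_dvd phi n)
     /\
     (lagr_order_dvd phi n <->
      exists B : finZmodType, #|B| = n /\ isometric_embedding_BBstar phi B))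
  /\
  (forall H : 'M[F]_n -> Prop, irreducible_SL_subgroup H ->
     exists H' : 'M[F]_n -> Prop,
       [/\ irreducible_SL_subgroup H',
           (forall g, in_U H g -> in_U H' g) &
           centralizer_card H' (n ^ 2)])
  /\
  (forall H : 'M[F]_n -> Prop, irreducible_SL_subgroup H ->
     (centralizer_card H (n ^ 2) <->
      (forall H' : 'M[F]_n -> Prop, irreducible_SL_subgroup H' ->
         (forall g, in_U H g -> in_U H' g) -> (forall g, in_U H' g -> in_U H g)))).
Proof.
split; [|split].
- move=> A phi phi_alt; split; split.
  + by move=> [H [irrH iso]]; exact: isometric_lagr iso.
  + exact: lagr_isometric.
  + move=> hn.
    have [W [B [om [i [_ [h4 h5 h6 cB]]]]]] := lagr_symplectic_cover n_gt0 phi_alt hn.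
    move=> [eb [ef [e1 e2 e3 e4 e5]]]; exists B; split=> //.
    exists (fun a => eb (i a)), (fun a => ef (i a)); split=> [a|a a'|a a' x|a a' h h'|a a'].
    * exact: e1.
    * by rewrite h4 e2.
    * by rewrite h4 e3.
    * by apply/h5/e4.
    * by rewrite -h6 e5.
  + move=> [B [cB emb]]; have [s sW] := BBstar_weyl n_gt0 xi_prim cB emb.
    exact: (weyl_lagr_order charF0 n_gt0 xi_prim phi_alt sW).
- exact: (irr_maximal_cover charF0 n_gt0 xi_prim).
- move=> H irrH; split=> [cH H' irrH' sub|maxH].
    exact: (card_maximal charF0 n_gt0 irrH' cH sub).
  (* Maximality identifies the centralizer of [H] with that of its cover [H'], which has order
     n^2. *)
  have [H' [irrH' sub cH']] := irr_maximal_cover charF0 n_gt0 xi_prim irrH.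
  apply: centralizer_card_eq cH' => g; split; first exact: sub.
  exact: maxH.
Qed.
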